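(* Fix $j\in\{1,2,3\}$ and integers $k,l\ge 2$ with $(k,l)\ne(2,2)$, where $k,l\le 5$ if $j=1$ and $k,l\le 3$ if $j\in\{2,3\}$. Consider the sequence of groups $\Gamma^j_{k,l,m}<\mathrm{Isom}(\mathbb{H}^3)$, where $m$ ranges over all integers $m\ge2$ with $\frac1k+\frac1l+\frac1m<1$. Then these groups represent infinitely many commensurability classes of cocompact reflection groups in $\mathbb{H}^3$. Moreover, the systoles of the Coxeter orbifolds $P^j_{k,l,m}=\mathbb{H}^3/\Gamma^j_{k,l,m}$ satisfy $\mathrm{sys}(P^j_{k,l,m})\to 0$ as $m\to+\infty$.
   Context: The prisms $P^j_{k,l,m}$. Put $p_1=3$, $p_2=4$, $p_3=5$. For $j\in\{1,2,3\}$ and integers $k,l,m\ge 2$ with $\frac1k+\frac1l+\frac1m<1$, where $k,l\le 5$ if $j=1$ and $k,l\le 3$ if $j=2,3$, $P^j_{k,l,m}$ denotes the compact Coxeter polyhedron in $\mathbb{H}^3$ (which exists and is unique up to isometry) that is combinatorially a triangular prism with lateral facets $F_1,F_2,F_3$ and triangular bases $B,T$, whose dihedral angles are: $\angle(F_1,F_2)=\pi/k$, $\angle(F_1,F_3)=\pi/l$, $\angle(F_2,F_3)=\pi/m$; $B$ is orthogonal to $F_1,F_2,F_3$; $\angle(T,F_1)=\pi/p_j$; $T$ is orthogonal to $F_2$ and $F_3$. The planes of $B$ and $T$ are disjoint. $\Gamma^j_{k,l,m}<\mathrm{Isom}(\mathbb{H}^3)$ is the discrete cocompact group generated by the reflections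 in the planes supporting the five facets of $P^j_{k,l,m}$. The polyhedron $P^j_{k,l,m}$ is identified with the orbifold $\mathbb{H}^3/\Gamma^j_{k,l,m}$. Two lattices $\Gamma_1,\Gamma_2<\mathrm{Isom}(\mathbb{H}^3)$ are commensurable if there is $g\in\mathrm{Isom}(\mathbb{H}^3)$ such that $\Gamma_1\cap g\Gamma_2g^{-1}$ has finite index in both $\Gamma_1$ and $g\Gamma_2g^{-1}$. The systole $\mathrm{sys}(\Gamma)$ of a lattice $\Gamma<\mathrm{Isom}(\mathbb{H}^d)$ is the minimal translation length of a loxodromic element of $\Gamma$, and the systole of the orbifold $M=\mathbb{H}^d/\Gamma$ is $\mathrm{sys}(M)=\mathrm{sys}(\Gamma)$. *)

(* Defs.v *)
From HB Require Import structures.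
From mathcomp Require Import all_boot all_order all_algebra.
From mathcomp Require Import all_classical all_reals all_analysis.
From mathcomp Require Import ring lra.
Import Order.TTheory GRing.Theory Num.Theory.
Import numFieldNormedType.Exports.

Set Implicit Arguments.
Unset Strict Implicit.
Unset Printing Implicit Defensive.

Local Open Scope classical_set_scope.
Local Open Scope ring_scope.

Definition lorentz (R : realType) (x y : 'rV[R]_4) : R :=
  - (x ord0 ord0 * y ord0 ord0)
  + \sum_(i < 3) x ord0 (lift ord0 i) * y ord0 (lift ord0 i).

(* Hyperboloid model of H^3. *)
Record hyp3 (R : realType) := Hyp3 {
  hval :> 'rV[R]_4 ;
  hyp3P : lorentz hval hval = -1 /\ 0 < hval ord0 ord0 }.

Definition arcosh (R : realType) (t : R) : R := ln (t + Num.sqrt (t ^+ 2 - 1)).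

Definition hdist (R : realType) (x y : hyp3 R) : R := arcosh (- lorentz x y).

(* Isom(H^3): distance-preserving bijections, including the
   orientation-reversing ones. *)
Record isom3 (R : realType) := Isom3 {
  isom_fun :> hyp3 R -> hyp3 R ;
  isom_bij : bijective isom_fun ;
  isom_dist : forall x y, hdist (isom_fun x) (isom_fun y) = hdist x y }.

Section IsomGroup.
Variable R : realType.
Implicit Types f g h : isom3 R.

Lemma hyp3_inj : injective (@hval R).
Proof.
move=> [x px] [y py] /= xy; move: px py; rewrite xy => px py.
by congr Hyp3; exact: Prop_irrelevance.
Qed.

Lemma isom3_ext f g : (forall x, f x = g x) -> f = g.
Proof.
case: f => f bf df; case: g => g bg dg /= /funext fg.
move: bf df bg dg; rewrite fg => bf df bg dg.
by congr Isom3; exact: Prop_irrelevance.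
Qed.

Definition isom_id : isom3 R :=
  @Isom3 R id (Bijective (fun=> erefl) (fun=> erefl)) (fun _ _ => erefl).

Lemma isom_comp_dist f g x y : hdist ((f \o g) x) ((f \o g) y) = hdist x y.
Proof. by rewrite /= !isom_dist. Qed.

Definition isom_comp f g : isom3 R :=
  Isom3 (bij_comp (isom_bij f) (isom_bij g)) (isom_comp_dist f g).

Lemma isom_inv_ex f : exists g : isom3 R, cancel f g /\ cancel g f.
Proof.
have [h fh hf] := isom_bij f.
have dh x y : hdist (h x) (h y) = hdist x y.
  by rewrite -(isom_dist f) !hf.
by exists (@Isom3 R h (Bijective hf fh) dh).
Qed.

Definition isom_inv f : isom3 R := projT1 (cid (isom_inv_ex f)).

Lemma isom_invK f : cancel f (isom_inv f) /\ cancel (isom_inv f) f.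
Proof. exact: projT2 (cid (isom_inv_ex f)). Qed.

HB.instance Definition _ := gen_eqMixin (isom3 R).
HB.instance Definition _ := gen_choiceMixin (isom3 R).

Lemma isom_compA : associative isom_comp.
Proof. by move=> f g h; apply: isom3_ext. Qed.

Lemma isom_comp1f : left_id isom_id isom_comp.
Proof. by move=> f; apply: isom3_ext. Qed.

Lemma isom_compf1 : right_id isom_id isom_comp.
Proof. by move=> f; apply: isom3_ext. Qed.

Lemma isom_compVf : left_inverse isom_id isom_inv isom_comp.
Proof. by move=> f; apply: isom3_ext => x /=; rewrite (isom_invK f).1. Qed.

Lemma isom_compfV : right_inverse isom_id isom_inv isom_comp.
Proof. by move=> f; apply: isom3_ext => x /=; rewrite (isom_invK f).2. Qed.

HB.instance Definition _ := isGroup.Build (isom3 R)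
  isom_compA isom_comp1f isom_compf1 isom_compVf isom_compfV.

End IsomGroup.

Section Subgroups.
Variable G : groupType.
Implicit Types H K : set G.

Definition is_subgroup H : Prop :=
  H 1%g /\ forall x y, H x -> H y -> H (x * y^-1)%g.

Definition generated_subgroup (S : set G) : set G := smallest is_subgroup S.

Definition conj_subgroup (g : G) H : set G :=
  [set (g * x * g^-1)%g | x in H].

Definition right_coset H (x : G) : set G := [set (h * x)%g | h in H].

Definition finite_index H K : Prop :=
  H `<=` K /\ finite_set [set right_coset H x | x in K].

Definition commensurable H K : Prop :=
  exists g : G,
    finite_index (H `&` conj_subgroup g K) H /\
    finite_index (H `&` conj_subgroup g K) (conj_subgroup g K).

Definition commensurability_class H : set (set G) :=
  [set K | is_subgroup K /\ commensurable H K].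

End Subgroups.

Section Systole.
Variable R : realType.

Definition translation_length (g : isom3 R) : R :=
  inf [set hdist x (g x) | x in [set: hyp3 R]].

(* The displacement function attains a positive minimum; g may rotate about
   its axis or reverse the orientation. *)
Definition loxodromic (g : isom3 R) : Prop :=
  exists x, 0 < hdist x (g x) /\ forall y, hdist x (g x) <= hdist y (g y).

(* For a lattice the infimum is a minimum. It is taken in \bar R so that a
   group without loxodromic elements would have systole +oo rather than the
   default value 0. *)
Definition systole (H : set (isom3 R)) : \bar R :=
  ereal_inf [set (translation_length g)%:E
            | g in [set g | H g /\ loxodromic g]].

End Systole.

Inductive facet := F1 | F2 | F3 | Bot | Top.

Section Prisms.
Variable R : realType.
(* outward normals of the five facets *)
Implicit Types n : facet -> 'rV[R]_4.

Definition polyhedron n : set (hyp3 R) :=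
  [set x | forall i, lorentz x (n i) <= 0].

Definition hplane (e : 'rV[R]_4) : set (hyp3 R) := [set x | lorentz x e = 0].

(* e and f are outward unit normals of two adjacent facets. *)
Definition dihedral_angle (e f : 'rV[R]_4) : R := pi - acos (lorentz e f).

(* A family of facets of a triangular prism has a common point iff it contains
   neither both bases nor all three lateral facets. The families with a common
   point that are maximal are the facet sets of the vertices, so for a compact
   polyhedron this fixes the vertex-facet incidences, hence the face lattice. *)
Definition combinatorial_prism n : Prop :=
  forall S : set facet,
    (exists x, polyhedron n x /\ forall i, S i -> hplane (n i) x) <->
    ~ (S Bot /\ S Top) /\ ~ (S F1 /\ S F2 /\ S F3).

Definition p_ (j : nat) : nat :=
  match j with 1 => 3 | 2 => 4 | _ => 5 end.

(* The polyhedron with outward unit normals n is P^j_{k,l,m}. *)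
Record is_coxeter_prism (j k l m : nat) n : Prop := {
  prism_unit : forall i, lorentz (n i) (n i) = 1 ;
  prism_interior : exists x : hyp3 R, forall i, lorentz x (n i) < 0 ;
  prism_compact : compact (@hval R @` polyhedron n) ;
  prism_type : combinatorial_prism n ;
  prism_F12 : dihedral_angle (n F1) (n F2) = pi / k%:R ;
  prism_F13 : dihedral_angle (n F1) (n F3) = pi / l%:R ;
  prism_F23 : dihedral_angle (n F2) (n F3) = pi / m%:R ;
  prism_B1 : dihedral_angle (n Bot) (n F1) = pi / 2 ;
  prism_B2 : dihedral_angle (n Bot) (n F2) = pi / 2 ;
  prism_B3 : dihedral_angle (n Bot) (n F3) = pi / 2 ;
  prism_T1 : dihedral_angle (n Top) (n F1) = pi / (p_ j)%:R ;
  prism_T2 : dihedral_angle (n Top) (n F2) = pi / 2 ;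
  prism_T3 : dihedral_angle (n Top) (n F3) = pi / 2 ;
  prism_BT : hplane (n Bot) `&` hplane (n Top) = set0 }.

Definition is_reflection (e : 'rV[R]_4) (g : isom3 R) : Prop :=
  forall x, hval (g x) = hval x - (2 * lorentz x e) *: e.

Definition reflection_group n : set (isom3 R) :=
  generated_subgroup [set g | exists i, is_reflection (n i) g].

End Prisms.

Definition admissible (k l : nat) : set nat :=
  [set m | (2 <= m)%N /\
           (k%:R^-1 + l%:R^-1 + m%:R^-1 < 1 :> rat)].

Section ReflectionExists.
Variable R : realType.
Implicit Types (x y e : 'rV[R]_4) (a : R).

Lemma lorentzC x y : lorentz x y = lorentz y x.
Proof.
rewrite /lorentz mulrC; congr (_ + _).
by apply: eq_bigr => i _; rewrite mulrC.
Qed.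

Lemma lorentzBZl x e y a : lorentz (x - a *: e) y = lorentz x y - a * lorentz e y.
Proof. by rewrite /lorentz !big_ord_recl !big_ord0 !mxE; ring. Qed.

Lemma lorentzBZr x e y a : lorentz y (x - a *: e) = lorentz y x - a * lorentz y e.
Proof. by rewrite lorentzC lorentzBZl !(lorentzC _ y). Qed.

Lemma lorentz_timelike_pos x y : lorentz x x = -1 -> lorentz y y = -1 ->
  0 < x ord0 ord0 -> lorentz x y < 0 -> 0 < y ord0 ord0.
Proof.
rewrite /lorentz !big_ord_recl !big_ord0.
set x0 := x ord0 ord0; set y0 := y ord0 ord0.
set x1 := x _ _; set x2 := x _ _; set x3 := x _ _.
set y1 := y _ _; set y2 := y _ _; set y3 := y _ _ => hx hy x0p hxy.
rewrite ltNge; apply/negP => y0n.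
have hs : x1 * y1 + x2 * y2 + x3 * y3 < x0 * y0 by lra.
have h0 : 0 <= x0 * - y0 by rewrite mulr_ge0 ?oppr_ge0// ltW.
have h1 : (x0 * y0) ^+ 2 < (x1 * y1 + x2 * y2 + x3 * y3) ^+ 2.
  move: hs h0; rewrite mulrN; set s := x1 * y1 + _ + _; set t := x0 * y0.
  by move=> hs h0; nra.
have hX : x0 ^+ 2 = 1 + (x1 ^+ 2 + x2 ^+ 2 + x3 ^+ 2) by lra.
have hY : y0 ^+ 2 = 1 + (y1 ^+ 2 + y2 ^+ 2 + y3 ^+ 2) by lra.
have h2 : (x1 * y1 + x2 * y2 + x3 * y3) ^+ 2 <=
    (x1 ^+ 2 + x2 ^+ 2 + x3 ^+ 2) * (y1 ^+ 2 + y2 ^+ 2 + y3 ^+ 2).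
  rewrite -subr_ge0.
  have -> : (x1 ^+ 2 + x2 ^+ 2 + x3 ^+ 2) * (y1 ^+ 2 + y2 ^+ 2 + y3 ^+ 2)
     - (x1 * y1 + x2 * y2 + x3 * y3) ^+ 2 =
     (x1 * y2 - x2 * y1) ^+ 2 + (x1 * y3 - x3 * y1) ^+ 2
     + (x2 * y3 - x3 * y2) ^+ 2 by ring.
  by rewrite !addr_ge0 ?sqr_ge0.
move: h1; rewrite exprMn hX hY.
have := sqr_ge0 x1; have := sqr_ge0 x2; have := sqr_ge0 x3.
have := sqr_ge0 y1; have := sqr_ge0 y2; have := sqr_ge0 y3.
move: h2; set u := x1 ^+ 2 + _ + _; set v := y1 ^+ 2 + _ + _ => h2.
move=> a1 a2 a3 a4 a5 a6.
have up : 0 <= u by rewrite /u; lra.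
have vp : 0 <= v by rewrite /v; lra.
lra.
Qed.

Lemma reflection_exists e : lorentz e e = 1 ->
  exists g : isom3 R, is_reflection e g.
Proof.
move=> ee.
pose r x := x - (2 * lorentz x e) *: e.
have rr x y : lorentz (r x) (r y) = lorentz x y.
  by rewrite /r !lorentzBZl !lorentzBZr ee (lorentzC e y); ring.
have rP (x : hyp3 R) : lorentz (r x) (r x) = -1 /\ 0 < r x ord0 ord0.
  have [xx xp] := hyp3P x; split; first by rewrite rr.
  apply: (lorentz_timelike_pos xx _ xp); first by rewrite rr.
  by rewrite /r lorentzBZr xx; nra.
pose f (x : hyp3 R) := Hyp3 (rP x).
have ff : cancel f f.
  move=> x; apply: hyp3_inj; rewrite /= {1}/r lorentzBZl ee.
  by apply/rowP => i; rewrite !mxE; ring.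
have fd (x y : hyp3 R) : hdist (f x) (f y) = hdist x y by rewrite /hdist /= rr.
by exists (@Isom3 R f (Bijective ff ff) fd).
Qed.

End ReflectionExists.

(* Main.v *)
(* The Gram matrix of the normals determines everything. Writing a, b, c, p for
   the cosines of pi/k, pi/l, pi/m, pi/p_j, the product s of the normals of B
   and T satisfies s^2 = 1 - p^2 (1 - c^2) / det, where det is the determinant
   of the Gram matrix of F1, F2, F3 and tends to -(a + b)^2 <> 0. Hence s^2
   tends to 1, and so does cosh(2 d(B,T)) = 2 s^2 - 1; since the product of the
   reflections in B and T is a translation by 2 d(B,T), the systoles tend to 0.

   For the commensurability classes, let m0 be fixed and m be a large prime.
   The entries of the Gram matrix of P_m0 are algebraic, so the group of P_m0
   preserves the K-span of the normals for some ring K of finite dimension over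
   Q, and its matrices lie in a space of finite dimension D over Q. Suppose that
   it is commensurable with the group of P_m, and let t be the conjugate of the
   rotation of order m about the edge F2 F3. If u is any element of the conjugate
   of the group of P_m, then for some N > 0 the elements t^i u^N t^-i all lie in
   the group of P_m0. If m - 1 > D, they satisfy a rational relation of degree
   less than m - 1, the degree of the irreducible cyclotomic polynomial, so t and
   u^N commute. This fails for the translation r_1 r_B r_T r_1. Thus m - 1 <= D,
   and a commensurability class contains only finitely many of the groups of
   prime m. *)
Require Import Defs.
From HB Require Import structures.
From mathcomp Require Import all_boot all_order all_algebra all_field.
From mathcomp Require Import all_classical all_reals all_analysis.
From mathcomp Require Import ring lra.
Import Order.TTheory GRing.Theory Num.Theory.
Import numFieldNormedType.Exports.

Set Implicit Arguments.
Unset Strict Implicit.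
Unset Printing Implicit Defensive.

Local Open Scope classical_set_scope.
Local Open Scope ring_scope.

(** * Spans over the rationals *)

Section RationalSpan.
Variable R : numFieldType.

Definition qspan (V : lmodType R) (J : finType) (w : J -> V) : set V :=
  [set v | exists q : J -> rat, v = \sum_j ratr (q j) *: w j].

Lemma qspan0 (V : lmodType R) (J : finType) (w : J -> V) : qspan w 0.
Proof.
by exists (fun=> 0); rewrite big1// => j _; rewrite rmorph0 scale0r.
Qed.

Lemma qspanD (V : lmodType R) (J : finType) (w : J -> V) u v :
  qspan w u -> qspan w v -> qspan w (u + v).
Proof.
move=> [p ->] [q ->]; exists (fun j => p j + q j).
by rewrite -big_split; apply: eq_bigr => j _; rewrite rmorphD scalerDl.
Qed.

Lemma qspanZ (V : lmodType R) (J : finType) (w : J -> V) a v :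
  qspan w v -> qspan w (ratr a *: v).
Proof.
move=> [q ->]; exists (fun j => a * q j).
by rewrite scaler_sumr; apply: eq_bigr => j _; rewrite rmorphM scalerA.
Qed.

Lemma qspan_sum (V : lmodType R) (J : finType) (w : J -> V)
    (I : finType) (F : I -> V) :
  (forall i, qspan w (F i)) -> qspan w (\sum_i F i).
Proof.
by move=> h; elim/big_rec: _ => [|i x _]; [exact: qspan0|exact: qspanD].
Qed.

Lemma qspan_id (V : lmodType R) (J : finType) (w : J -> V) j : qspan w (w j).
Proof.
exists (fun i => (i == j)%:R); rewrite (bigD1 j)//= eqxx rmorph1 scale1r.
rewrite big1 ?addr0// => i /negbTE ->; by rewrite rmorph0 scale0r.
Qed.

Lemma qspan_scale (V : lmodType R) (I J : finType) (e : I -> R^o)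
    (w : J -> V) (x : R) v :
  qspan e x -> qspan w v -> qspan (fun ij => e ij.1 *: w ij.2) (x *: v).
Proof.
move=> [p ->] [q ->]; rewrite scaler_suml; apply: qspan_sum => i.
rewrite -scalerA; apply: qspanZ; rewrite scaler_sumr; apply: qspan_sum => j.
rewrite scalerA mulrC -scalerA; apply: qspanZ.
exact: (qspan_id (fun ij => e ij.1 *: w ij.2) (i, j)).
Qed.

Lemma qspan_sum_linear (V W : lmodType R) (I J : finType) (w : J -> V)
    (f : I -> {linear V -> W}) (v : I -> V) :
  (forall i, qspan w (v i)) ->
  qspan (fun ij => f ij.1 (w ij.2)) (\sum_i f i (v i)).
Proof.
move=> wv; apply: qspan_sum => i; have [q ->] := wv i.
rewrite linear_sum; apply: qspan_sum => j; rewrite linearZ; apply: qspanZ.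
exact: (qspan_id (fun ij => f ij.1 (w ij.2)) (i, j)).
Qed.

(** The coefficient matrix has more rows than columns, so its left kernel is nonzero. The relation
    is stored as a polynomial so that it can be compared with a cyclotomic one. *)
Lemma qspan_dependent (V : lmodType R) (J : finType) (w : J -> V) n
    (X : nat -> V) :
  (#|J| < n)%N -> (forall i, (i < n)%N -> qspan w (X i)) ->
  exists q : {poly rat},
    [/\ q != 0, (size q <= n)%N & \sum_(i < n) ratr q`_i *: X i = 0].
Proof.
move=> Jn wX.
have [A XA] : exists A : 'M[rat]_(n, #|J|), forall i : 'I_n,
    X i = \sum_j ratr (A i j) *: w (enum_val j).
  have [c Xc] := choice (fun i : 'I_n => wX i (ltn_ord i)).
  exists (\matrix_(i, j) c i (enum_val j)) => i; rewrite Xc.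
  rewrite (reindex (@enum_val J J)) /=; last first.
    by exists enum_rank => j _; [exact: enum_valK|exact: enum_rankK].
  by apply: eq_bigr => j _; rewrite mxE.
have : kermx A != 0.
  rewrite -mxrank_eq0 mxrank_ker -lt0n subn_gt0.
  by rewrite (leq_ltn_trans (rank_leq_col A)).
case/rowV0Pn => u /sub_kermxP uA u0.
exists (rVpoly u); split.
- by apply: contraNneq u0 => /(congr1 (@poly_rV _ n)); rewrite rVpolyK linear0 => ->.
- exact: size_poly.
- under eq_bigr do rewrite coef_rVpoly_ord XA scaler_sumr.
  rewrite exchange_big big1// => j _.
  under eq_bigr do rewrite scalerA -rmorphM.
  rewrite -scaler_suml -rmorph_sum.
  have := congr1 (fun M : 'rV_ _ => M ord0 j) uA; rewrite !mxE => ->.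
  by rewrite rmorph0 scale0r.
Qed.

(** This plays the role of a number field: a subring of [R] of finite dimension over the rationals,
    given by spanning elements. *)
Definition qring (I : finType) (e : I -> R) : Prop :=
  qspan (e : I -> R^o) 1 /\
  forall x y, qspan (e : I -> R^o) x -> qspan (e : I -> R^o) y ->
    qspan (e : I -> R^o) (x * y : R).

(** The products of the generators span the compositum of the two rings. *)
Lemma qring_prod (I J : finType) (e : I -> R) (f : J -> R) :
  qring e -> qring f -> qring (fun ij : I * J => e ij.1 * f ij.2).
Proof.
move=> [e1 eM] [f1 fM]; split.
  by rewrite -[1](mulr1 1); exact: (@qspan_scale R^o _ _ e f).
move=> x y [p ->] [q ->]; rewrite mulr_suml; apply: qspan_sum => i.
rewrite mulr_sumr; apply: qspan_sum => j.
have -> : (ratr (p i) *: (e i.1 * f i.2 : R^o)) *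
          (ratr (q j) *: (e j.1 * f j.2 : R^o)) =
    ratr (p i) *: (ratr (q j) *: ((e i.1 * e j.1) *: (f i.2 * f j.2 : R^o))).
  by rewrite /GRing.scale/=; ring.
by do 2 apply: qspanZ; apply: (@qspan_scale R^o); [apply: eM|apply: fM];
  exact: (qspan_id (_ : _ -> R^o)).
Qed.

Lemma qring_prodl (I J : finType) (e : I -> R) (f : J -> R) x :
  qring f -> qspan (e : _ -> R^o) x ->
  qspan ((fun ij : I * J => e ij.1 * f ij.2) : _ -> R^o) x.
Proof. by move=> [f1 _] ex; rewrite -[x]mulr1; exact: (@qspan_scale R^o). Qed.

Lemma qring_prodr (I J : finType) (e : I -> R) (f : J -> R) x :
  qring e -> qspan (f : _ -> R^o) x ->
  qspan ((fun ij : I * J => e ij.1 * f ij.2) : _ -> R^o) x.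
Proof. by move=> [e1 _] fx; rewrite -[x]mul1r; exact: (@qspan_scale R^o). Qed.

(** Reduction modulo an annihilating polynomial [p] shows that the powers of [x] below [size p] span
    all rational polynomials in [x]. *)
Lemma algebraic_qring (x : R) : algebraicOver (ratr : rat -> R) x ->
  exists (I : finType) (e : I -> R), qring e /\ qspan (e : I -> R^o) x.
Proof.
move=> [p p0 px].
pose e (i : 'I_(size p)) := x ^+ i.
have eh q : qspan (e : _ -> R^o) (map_poly ratr q).[x].
  have -> : (map_poly ratr q).[x] = (map_poly ratr (q %% p)).[x].
    rewrite {1}(divp_eq q p) rmorphD rmorphM/= hornerD hornerM.
    by rewrite (rootP px) mulr0 add0r.
  exists (fun i : 'I_(size p) => (q %% p)`_i).
  rewrite (@horner_coef_wide _ (size p)).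
    by apply: eq_bigr => i _; rewrite coef_map.
  by rewrite size_map_poly ltnW// ltn_modp.
have he y : qspan (e : _ -> R^o) y -> exists q, y = (map_poly ratr q).[x].
  move=> [c ->]; exists (\sum_i c i *: 'X^i).
  rewrite rmorph_sum horner_sum; apply: eq_bigr => i _.
  by rewrite /= map_polyZ map_polyXn hornerZ hornerXn.
exists _, e; split; first split.
- by have := eh 1; rewrite rmorph1 hornerC.
- by move=> y z /he[q ->] /he[r ->]; rewrite -hornerM -rmorphM; exact: eh.
- by have := eh 'X; rewrite map_polyX hornerX.
Qed.

Lemma seq_algebraic_qring (s : seq R) :
  (forall x, x \in s -> algebraicOver (ratr : rat -> R) x) ->
  exists (I : finType) (e : I -> R), qring e /\
    forall x, x \in s -> qspan (e : I -> R^o) x.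
Proof.
elim: s => [_|x s IH xs].
  have [I [e [eR _]]] := algebraic_qring (algebraic1 (ratr : rat -> R)).
  by exists I, e.
have [I [e [eR es]]] := IH (fun y ys => xs y (mem_behead (s := x :: s) ys)).
have [J [f [fR fx]]] := algebraic_qring (xs x (mem_head _ _)).
exists _, (fun ij : I * J => e ij.1 * f ij.2); split; first exact: qring_prod.
move=> y; rewrite inE => /orP[/eqP ->|/es ey]; first exact: qring_prodr.
exact: qring_prodl.
Qed.
End RationalSpan.

(** * Cyclotomic relations and algebraic cosines *)

(** Here [X^m - 1 = (X - 1) S], where [S] is the cyclotomic polynomial, irreducible of degree
    [m - 1]. As [q] has smaller degree, it is coprime to [S], and a Bezout relation between them is
    multiplied by [X - 1]. *)
Lemma prime_cyclotomic_Bezout m (q : {poly rat}) :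
  prime m -> q != 0 -> (size q < m)%N ->
  exists u v : {poly rat}, u * ('X^m - 1) + v * q = 'X - 1.
Proof.
move=> pm q0 qm.
have m0 := prime_gt0 pm.
have [z zm] := C_prim_root_exists m0.
have [p [Dp p_monic] pmin] := minCpolyP z.
have sp : size p = m.
  have := size_map_poly (ratr : {rmorphism rat -> algC}) p.
  rewrite -Dp (minCpoly_cyclotomic zm) size_cyclotomic totient_prime//.
  by rewrite prednK.
have p0 := monic_neq0 p_monic.
pose S : {poly rat} := \sum_(i < m) 'X^i.
have XS : 'X^m - 1 = ('X - 1) * S := subrX1 _ _.
have Sz : root (map_poly ratr S) z.
  have z1 : z != 1.
    apply: contraTneq (prime_gt1 pm) => z1.
    by rewrite -leqNgt dvdn_leq// (prim_order_dvd zm) z1 expr1n.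
  have : root (map_poly ratr ('X^m - 1 : {poly rat})) z.
    rewrite rmorphB/= map_polyXn rmorph1 rootE hornerD hornerN hornerC.
    by rewrite hornerXn (prim_expr_order zm) subrr.
  rewrite XS rmorphM rmorphB/= map_polyX rmorph1 rootM => /orP[|//].
  by rewrite root_XsubC (negbTE z1).
(* The minimal polynomial [p] of [z] divides [S], and both have size [m]. *)
have pS : p %= S.
  rewrite -dvdp_size_eqp -?pmin// sp /S eqn_leq.
  have -> : \sum_(i < m) 'X^i = \poly_(i < m) (1 : rat).
    by rewrite poly_def; apply: eq_bigr => i _; rewrite scale1r.
  by rewrite size_poly_eq ?leqnn//= oner_eq0.
have SqC : coprimep S q.
  rewrite -(eqp_coprimepl _ pS).
  have /divpK De := dvdp_gcdl p q; set d := gcdp p q in De *.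
  have d0 : d != 0 by rewrite gcdp_eq0 (negbTE p0).
  have e0 : p %/ d != 0 by apply: contraNneq p0 => e0; rewrite -De e0 mul0r.
  (* [z] is a root of [p %/ d] or of [d], so [p] divides one of them. In the first case [d] is
     constant; in the second [p] would divide [q], against the sizes. *)
  have : root (map_poly ratr p) z by rewrite pmin dvdpp.
  rewrite -De rmorphM/= rootM !pmin De => /orP[pe|pd].
    rewrite coprimep_def -/d; have := size_mul e0 d0; rewrite De.
    have := dvdp_leq e0 pe; have : size d != 0%N by rewrite size_poly_eq0.
    case: (size d) => [//|n] _.
    case: (size (p %/ d)) => [|k]; first by rewrite leqn0 size_poly_eq0 (negbTE p0).
    rewrite addSn addnS/= => + pE; rewrite pE -[leqRHS]addn0 -addSn leq_add2l.
    by rewrite leqn0.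
  have := dvdp_leq q0 (dvdp_trans pd (dvdp_gcdr _ _)).
  by rewrite sp leqNgt qm.
have /Bezout_coprimepP[[u v] /= uv] := SqC.
have [c c0 cE] : exists2 c, c != 0 & u * S + v * q = c%:P.
  by apply/size_poly1P; rewrite size_poly_eq1.
exists (c^-1%:P * u), (c^-1%:P * ('X - 1) * v).
rewrite XS.
transitivity (c^-1%:P * ('X - 1) * (u * S + v * q)); first by ring.
by rewrite cE mulrAC -polyCM mulVf// mul1r.
Qed.

(** The rational polynomials in [C] that kill [v] form an ideal. It contains [X^m - 1] and [q],
    hence also [X - 1]. *)
Lemma prime_period_rational_relation (R : numFieldType) n (C : 'M[R]_n.+1)
    (v : 'rV[R]_n.+1) m (q : {poly rat}) :
  prime m -> q != 0 -> (size q <= m.-1)%N -> v *m C ^+ m = v ->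
  \sum_(i < m.-1) ratr q`_i *: (v *m C ^+ i) = 0 -> v *m C = v.
Proof.
move=> pm q0 qm vCm vq.
pose h (p : {poly rat}) := horner_mx C (map_poly ratr p).
have hM p r : h (p * r) = h p *m h r by rewrite /h !rmorphM.
have hC p r : h p *m h r = h r *m h p by rewrite -!hM mulrC.
have [|u [w uw]] := prime_cyclotomic_Bezout pm q0.
  by rewrite (leq_ltn_trans qm)// prednK ?prime_gt0.
have hXm : v *m h ('X^m - 1) = 0.
  rewrite /h !rmorphB/= map_polyXn rmorph1 rmorph1 rmorphXn/= horner_mx_X.
  by rewrite mulmxBr vCm mulmx1 subrr.
have hq : v *m h q = 0.
  rewrite -vq /h [map_poly _ _]poly_def.
  have -> : \sum_(i < size q) ratr q`_i *: 'X^i =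
      \sum_(i < m.-1) ratr q`_i *: 'X^i :> {poly R}.
    rewrite (big_ord_widen _ (fun i => ratr q`_i *: 'X^i) qm).
    rewrite [RHS](bigID (fun i : 'I__ => (i < size q)%N))/=.
    rewrite [X in _ = _ + X]big1 ?addr0// => i.
    by rewrite -leqNgt => /(nth_default 0) ->; rewrite rmorph0 scale0r.
  rewrite rmorph_sum mulmx_sumr; apply: eq_bigr => i _.
  by rewrite /= linearZ/= rmorphXn/= horner_mx_X scalemxAr.
have : v *m h ('X - 1) = 0.
  rewrite -uw /h !rmorphD/= mulmxDr -/(h _) -/(h (w * q)) !hM.
  by rewrite (hC u) (hC w) !mulmxA hXm hq !mul0mx addr0.
rewrite /h !rmorphB/= map_polyX !rmorph1 horner_mx_X mulmxBr mulmx1.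
by move/eqP; rewrite subr_eq0 => /eqP.
Qed.

Section CosAlgebraic.
Variable R : realType.

(** These are the Chebyshev polynomials of the first kind; the value at 1 serves to show that
    [p + 1] is nonzero. *)
Lemma cos_mulrn_poly n : exists p : {poly rat},
  p.[1] = 1 /\ forall x : R, (map_poly ratr p).[cos x] = cos (n%:R * x).
Proof.
(* The recurrence [T_(n+2) = 2 X T_(n+1) - T_n] involves two consecutive polynomials. *)
suff [p [q [p1 _ pE _]]] : exists p q : {poly rat}, [/\ p.[1] = 1, q.[1] = 1,
    forall x : R, (map_poly ratr p).[cos x] = cos (n%:R * x) &
    forall x : R, (map_poly ratr q).[cos x] = cos (n.+1%:R * x)].
  by exists p.
elim: n => [|n [p [q [p1 q1 pE qE]]]].
  exists 1, 'X; split; rewrite ?hornerC ?hornerX// => x.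
    by rewrite rmorph1 hornerC mul0r cos0.
  by rewrite map_polyX hornerX mul1r.
exists q, (2%:P * 'X * q - p); split => // [|x].
  by rewrite !hornerE p1 q1; ring.
rewrite rmorphB !rmorphM/= map_polyX map_polyC/= rmorph_nat.
rewrite hornerD hornerN !hornerM hornerC hornerX pE qE.
have -> : n%:R * x = n.+1%:R * x - x by rewrite -natr1; ring.
have -> : n.+2%:R * x = n.+1%:R * x + x by rewrite -(natr1 n.+1); ring.
by rewrite cosB cosD; ring.
Qed.

(** Since [cos pi = -1], this is a root of the Chebyshev polynomial plus 1. *)
Lemma algebraic_cos_pi_div n : (0 < n)%N ->
  algebraicOver (ratr : rat -> R) (cos (pi / n%:R)).
Proof.
move=> n0; have [p [p1 pE]] := cos_mulrn_poly n.
exists (p + 1).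
  apply/eqP => /(congr1 (horner^~ 1)); rewrite hornerD p1 !hornerC.
  by move/eqP; rewrite (_ : 1 + 1 = 2%:R)// pnatr_eq0.
rewrite rmorphD/= rmorph1 rootE hornerD pE hornerC mulrC divfK ?pnatr_eq0 -?lt0n//.
by rewrite cospi addNr.
Qed.

Lemma algebraic_sqr (x : R) :
  algebraicOver (ratr : rat -> R) (x ^+ 2) -> algebraicOver (ratr : rat -> R) x.
Proof.
move=> [p p0 px]; exists (p \Po 'X^2).
  by rewrite comp_poly_eq0 ?size_polyXn.
by rewrite map_comp_poly map_polyXn rootE horner_comp hornerXn.
Qed.
End CosAlgebraic.

(** * The Lorentz form and isometries as matrices *)

Section LorentzForm.
Variable R : realType.
Implicit Types (x y z e : 'rV[R]_4) (a : R).

Lemma lorentzDl x y z : lorentz (x + y) z = lorentz x z + lorentz y z.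
Proof. by rewrite /lorentz !big_ord_recl !big_ord0 !mxE; ring. Qed.

Lemma lorentzZl a x z : lorentz (a *: x) z = a * lorentz x z.
Proof. by rewrite /lorentz !big_ord_recl !big_ord0 !mxE; ring. Qed.

Lemma lorentzDr x y z : lorentz z (x + y) = lorentz z x + lorentz z y.
Proof. by rewrite !(lorentzC z) lorentzDl. Qed.

Lemma lorentzZr a x z : lorentz z (a *: x) = a * lorentz z x.
Proof. by rewrite !(lorentzC z) lorentzZl. Qed.

Lemma lorentz0l z : lorentz 0 z = 0.
Proof. by rewrite -(scale0r 0) lorentzZl mul0r. Qed.

Lemma lorentzNl x z : lorentz (- x) z = - lorentz x z.
Proof. by rewrite -scaleN1r lorentzZl mulN1r. Qed.

Lemma lorentzNr x z : lorentz z (- x) = - lorentz z x.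
Proof. by rewrite !(lorentzC z) lorentzNl. Qed.

(** Cauchy-Schwarz for the spatial parts gives [x0^2 y0^2 <= u v], and [v < y0^2] because [y] is
    timelike. *)
Lemma lorentz_timelike_orthogonal x y :
  lorentz y y < 0 -> lorentz x y = 0 -> 0 <= lorentz x x.
Proof.
rewrite /lorentz !big_ord_recl !big_ord0.
set x0 := x ord0 ord0; set y0 := y ord0 ord0.
set x1 := x _ _; set x2 := x _ _; set x3 := x _ _.
set y1 := y _ _; set y2 := y _ _; set y3 := y _ _ => yy xy.
pose u := x1 ^+ 2 + x2 ^+ 2 + x3 ^+ 2; pose v := y1 ^+ 2 + y2 ^+ 2 + y3 ^+ 2.
have v0 : 0 <= v by rewrite !addr_ge0 ?sqr_ge0.
have u0 : 0 <= u by rewrite !addr_ge0 ?sqr_ge0.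
have vy : v < y0 ^+ 2 by rewrite /v; lra.
have cs : (x0 * y0) ^+ 2 <= u * v.
  rewrite (_ : x0 * y0 = x1 * y1 + x2 * y2 + x3 * y3); last by lra.
  rewrite -subr_ge0 (_ : _ - _ = (x1 * y2 - x2 * y1) ^+ 2
    + (x1 * y3 - x3 * y1) ^+ 2 + (x2 * y3 - x3 * y2) ^+ 2).
    by rewrite !addr_ge0 ?sqr_ge0.
  by rewrite /u /v; ring.
suff : x0 ^+ 2 <= u by rewrite /u; lra.
have y0p : 0 < y0 ^+ 2 by exact: le_lt_trans vy.
rewrite -(ler_pM2r y0p) -exprMn (le_trans cs)//.
by rewrite ler_wpM2l// ltW.
Qed.

(** The component of [x] orthogonal to [y] has nonnegative square, so the product has square at
    least 1. This puts all distances in the range where [arcosh] is injective. *)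
Lemma lorentz_hyp3_le (x y : hyp3 R) : 1 <= - lorentz x y.
Proof.
have [xx xp] := hyp3P x; have [yy yp] := hyp3P y.
have : 0 <= lorentz (hval x + lorentz x y *: hval y) (hval x + lorentz x y *: hval y).
  apply: (@lorentz_timelike_orthogonal _ y); first by rewrite yy ltrN10.
  by rewrite lorentzDl lorentzZl yy; lra.
rewrite lorentzDl !lorentzDr !lorentzZl !lorentzZr xx yy (lorentzC y x) => h.
have xy0 : lorentz x y <= 0.
  (* A positive product would put [- y] on the same sheet as [x]. *)
  rewrite leNgt; apply/negP => xy.
  have := lorentz_timelike_pos xx (y := - hval y).
  rewrite lorentzNl !lorentzNr opprK yy mxE => /(_ erefl xp).
  by rewrite oppr_lt0 oppr_gt0 => /(_ xy); rewrite ltNge ltW.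
nra.
Qed.

Definition lorentz_mx : 'M[R]_4 :=
  diag_mx (\row_i (if i == ord0 then -1 else 1)).

Lemma lorentz_mxE x y : lorentz x y = (x *m lorentz_mx *m y^T) ord0 ord0.
Proof.
rewrite /lorentz_mx mul_mx_diag mxE /lorentz [RHS]big_ord_recl !mxE/=.
congr (_ + _); first by rewrite mulrN1 mulNr.
by apply: eq_bigr => i _; rewrite !mxE/= mulr1.
Qed.

Lemma lorentz_mxK : lorentz_mx *m lorentz_mx = 1%:M.
Proof.
rewrite mulmx_diag -diag_const_mx; congr diag_mx.
by apply/rowP => i; rewrite !mxE; case: ifP => _; ring.
Qed.

End LorentzForm.

Section Arcosh.
Variable R : realType.
Implicit Types s t : R.

Lemma arcosh1 : arcosh (1 : R) = 0.
Proof. by rewrite /arcosh expr1n subrr sqrtr0 addr0 ln1. Qed.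

Lemma arcosh_lt s t : 1 <= s -> s < t -> arcosh s < arcosh t.
Proof.
move=> s1 st; rewrite /arcosh ltr_ln ?posrE.
- by rewrite ltr_leD// ler_wsqrtr// lerD2r; nra.
- by have := sqrtr_ge0 (s ^+ 2 - 1); lra.
- by have := sqrtr_ge0 (t ^+ 2 - 1); lra.
Qed.

Lemma arcosh_le s t : 1 <= s -> s <= t -> arcosh s <= arcosh t.
Proof.
by move=> s1; rewrite le_eqVlt => /orP[/eqP ->//|/(arcosh_lt s1)/ltW].
Qed.

Lemma arcosh_ge0 t : 1 <= t -> 0 <= arcosh t.
Proof. by move=> t1; rewrite -arcosh1 arcosh_le. Qed.

Lemma arcosh_inj s t : 1 <= s -> 1 <= t -> arcosh s = arcosh t -> s = t.
Proof.
move=> s1 t1 st; case: (ltgtP s t) => // [/(arcosh_lt s1)|/(arcosh_lt t1)];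
  by rewrite st ltxx.
Qed.

Lemma cvg_arcosh1 : arcosh t @[t --> (1 : R)] --> (0 : R).
Proof.
rewrite -arcosh1 /arcosh.
apply: (@cvg_comp _ _ _ (fun t => t + Num.sqrt (t ^+ 2 - 1)) (@ln R)); last first.
  by apply: continuous_ln; rewrite expr1n subrr sqrtr0 addr0.
apply: cvgD; first exact: cvg_id.
apply: (@cvg_comp _ _ _ (fun t : R => t ^+ 2 - 1) Num.sqrt); last first.
  exact: sqrt_continuous.
by apply: cvgB; [exact: exprn_continuous|exact: cvg_cst].
Qed.

End Arcosh.

Section IsometryMatrix.
Variable R : realType.

Lemma hyp3_basis : exists b : 'I_4 -> hyp3 R,
  \matrix_i hval (b i) \in unitmx.
Proof.
(* These four points form a lower triangular matrix with ones on the diagonal. *)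
pose v (i : 'I_4) : 'rV[R]_4 :=
  if i == ord0 then delta_mx ord0 ord0
  else Num.sqrt 2 *: delta_mx ord0 ord0 + delta_mx ord0 i.
have s2 : Num.sqrt 2 * Num.sqrt 2 = 2 :> R by rewrite -expr2 sqr_sqrtr.
have vP i : lorentz (v i) (v i) = -1 /\ 0 < v i ord0 ord0.
  rewrite /lorentz !big_ord_recl !big_ord0 /v.
  case: i => -[|[|[|[|//]]]] ?; rewrite /= !mxE /= ?mulr0 ?mulr1 ?addr0 ?add0r;
  by split; rewrite ?s2 ?sqrtr_gt0//; lra.
exists (fun i => Hyp3 (vP i)) => /=.
rewrite unitmxE det_trig ?unitfE; last first.
  apply/is_trig_mxP => i j ij; rewrite mxE /v.
  case: ifP => [/eqP i0|_]; rewrite !mxE/=.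
    by rewrite -[j == _]negbK -val_eqE/= -lt0n (leq_ltn_trans _ ij).
  by rewrite -!val_eqE/= !gtn_eqF ?mulr0 ?addr0 ?(leq_ltn_trans _ ij).
rewrite prodf_seq_neq0; apply/allP => i _ /=; rewrite !mxE /v.
case: ifP => [/eqP ->|i0]; rewrite !mxE eqxx ?oner_eq0//= i0 mulr0 add0r oner_eq0.
Qed.

Lemma hyp3_mx_ext (A B : 'M[R]_4) :
  (forall x : hyp3 R, hval x *m A = hval x *m B) -> A = B.
Proof.
move=> AB; have [b bU] := hyp3_basis.
rewrite -(mulKmx bU A) -(mulKmx bU B); congr (_ *m _).
by apply/row_matrixP => i; rewrite !row_mul rowK AB.
Qed.

Lemma isom_lorentz (f : isom3 R) x y : lorentz (f x) (f y) = lorentz x y.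
Proof.
apply: oppr_inj; apply: arcosh_inj; try exact: lorentz_hyp3_le.
exact: isom_dist.
Qed.

(* An isometry is determined by the products with the images of a basis. *)
Lemma isom_linear (f : isom3 R) :
  exists A : 'M[R]_4, forall x, hval (f x) = hval x *m A.
Proof.
have [b bU] := hyp3_basis.
set B := \matrix_i _ in bU; pose B' := \matrix_i hval (f (b i)).
pose L := lorentz_mx R.
have LU : L \in unitmx by case: (mulmx1_unit (lorentz_mxK R)).
(* The images of the basis have the same Gram matrix as the basis, so they form a basis too. *)
have BB : B' *m L *m B'^T = B *m L *m B^T.
  apply/matrixP => i j.
  have rowE (C : 'M[R]_4) : (C *m L *m C^T) i j = lorentz (row i C) (row j C).
    by rewrite lorentz_mxE -row_mul [LHS]mxE [RHS]mxE;
      apply: eq_bigr => k _; rewrite !mxE.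
  by rewrite !rowE !rowK isom_lorentz.
have B'U : B'^T \in unitmx.
  have : B' *m L *m B'^T \in unitmx by rewrite BB !unitmx_mul bU LU unitmx_tr.
  by rewrite unitmx_mul => /andP[].
exists (L *m B^T *m invmx (L *m B'^T)) => x.
have LB'U : L *m B'^T \in unitmx by rewrite unitmx_mul LU.
rewrite mulmxA -[LHS](mulmxK LB'U); congr (_ *m _).
apply/rowP => i.
have colE (y : 'rV[R]_4) (C : 'M[R]_4) :
    (y *m (L *m C^T)) ord0 i = lorentz y (row i C).
  by rewrite lorentz_mxE mulmxA [LHS]mxE [RHS]mxE; apply: eq_bigr => k _; rewrite !mxE.
by rewrite !colE !rowK isom_lorentz.
Qed.

Definition isom_mx (f : isom3 R) : 'M[R]_4 := projT1 (cid (isom_linear f)).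

Lemma isom_mxE (f : isom3 R) x : hval (f x) = hval x *m isom_mx f.
Proof. exact: projT2 (cid (isom_linear f)) x. Qed.

Lemma isom_mx_inj : injective isom_mx.
Proof.
move=> f g fg; apply: isom3_ext => x; apply: hyp3_inj.
by rewrite !isom_mxE fg.
Qed.

Lemma isom_mx1 : isom_mx 1%g = 1%:M.
Proof. by apply: hyp3_mx_ext => x; rewrite -isom_mxE mulmx1. Qed.

(** Matrices act on row vectors from the right, which reverses the order of the factors. *)
Lemma isom_mxM f g : isom_mx (f * g)%g = isom_mx g *m isom_mx f.
Proof. by apply: hyp3_mx_ext => x; rewrite mulmxA -!isom_mxE. Qed.

Lemma isom_mxX f n : isom_mx (f ^+ n)%g = isom_mx f ^+ n.
Proof.
elim: n => [|n IHn]; first by rewrite isom_mx1.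
by rewrite expgS isom_mxM IHn exprSr.
Qed.

(** The formula passes from points of the hyperboloid, which span the space, to all vectors, and so
    can be applied to the normals. *)
Lemma reflection_mxE (e : 'rV[R]_4) (f : isom3 R) (v : 'rV[R]_4) :
  is_reflection e f -> v *m isom_mx f = v - (2 * lorentz v e) *: e.
Proof.
move=> fe; pose L := lorentz_mx R.
have rE (w : 'rV[R]_4) :
    w *m (1%:M - 2 *: (L *m e^T *m e)) = w - (2 * lorentz w e) *: e.
  rewrite mulmxBr mulmx1 -scalemxAr !mulmxA [w *m L *m e^T]mx11_scalar.
  by rewrite -lorentz_mxE mul_scalar_mx scalerA.
rewrite -rE; congr (_ *m _); apply: hyp3_mx_ext => x.
by rewrite -isom_mxE rE fe.
Qed.

End IsometryMatrix.

(** * Subgroups and translations *)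

Section Subgroups.
Variable G : groupType.
Implicit Types (H K : set G) (x y : G).
Local Open Scope group_scope.

Lemma subgroupV H x : is_subgroup H -> H x -> H x^-1.
Proof. by move=> [H1 HM] Hx; rewrite -[x^-1]mul1g; apply: HM. Qed.

Lemma subgroupM H x y : is_subgroup H -> H x -> H y -> H (x * y).
Proof.
by move=> sH Hx Hy; rewrite -[y]invgK; apply: sH.2 => //; exact: subgroupV.
Qed.

Lemma subgroupX H x i : is_subgroup H -> H x -> H (x ^+ i).
Proof.
move=> sH Hx; elim: i => [|i IHi]; first exact: sH.1.
by rewrite expgS; exact: subgroupM.
Qed.

Lemma subgroupI H K : is_subgroup H -> is_subgroup K -> is_subgroup (H `&` K).
Proof.
move=> [H1 HM] [K1 KM]; split=> // x y [Hx Kx] [Hy Ky].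
by split; [apply: HM|apply: KM].
Qed.

Lemma conj_subgroup_subgroup g H :
  is_subgroup H -> is_subgroup (conj_subgroup g H).
Proof.
move=> [H1 HM]; split; first by exists 1; rewrite ?mulg1 ?mulgV.
move=> _ _ [x Hx <-] [y Hy <-]; exists (x * y^-1); first exact: HM.
by rewrite !invgM invgK !mulgA mulgVK.
Qed.

Lemma conj_subgroup1 H : conj_subgroup 1 H = H.
Proof.
by apply/seteqP; split=> [_ [x Hx <-]|x Hx];
  [|exists x => //]; rewrite invg1 mul1g mulg1.
Qed.

Lemma generated_subgroup_subgroup (S : set G) :
  is_subgroup (generated_subgroup S).
Proof.
split=> [H [sH _]|x y Sx Sy H SH]; first exact: sH.1.
by apply: SH.1.2; [exact: Sx|exact: Sy].
Qed.

Lemma sub_generated_subgroup (S : set G) : S `<=` generated_subgroup S.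
Proof. by move=> x Sx H [_]; apply. Qed.

Lemma finite_index_refl H : is_subgroup H -> finite_index H H.
Proof.
move=> sH; split=> //; apply: (@sub_finite_set _ _ [set H]) => //.
move=> _ [x Hx <-]; apply/seteqP; split=> [_ [h Hh <-]|y Hy].
  exact: subgroupM.
exists (y * x^-1); last by rewrite mulgVK.
by apply: subgroupM => //; exact: subgroupV.
Qed.

Lemma commensurable_refl H : is_subgroup H -> commensurable H H.
Proof.
move=> sH; exists 1; rewrite conj_subgroup1 setIid.
by split; exact: finite_index_refl.
Qed.

(** By pigeonhole two powers of [x] lie in the same coset of [H]; their quotient is a positive power
    of [x] in [H]. *)
Lemma finite_index_expg H K x : is_subgroup H -> is_subgroup K ->
  finite_index H K -> K x -> exists2 i, (0 < i)%N & H (x ^+ i).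
Proof.
move=> sH sK [_]; set C := (X in finite_set X) => fin Kx.
have [//|Ninj] := pselect (exists2 i, (0 < i)%N & H (x ^+ i)).
have lt_inj i j : (i < j)%N -> right_coset H (x ^+ i) <> right_coset H (x ^+ j).
  move=> ij eij; apply: Ninj; exists (j - i)%N; first by rewrite subn_gt0.
  have : right_coset H (x ^+ j) (x ^+ j).
    by exists 1; [exact: sH.1|rewrite mul1g].
  by rewrite -eij => -[h Hh hx]; rewrite expgnFr 1?ltnW// -hx mulgK.
pose c i := right_coset H (x ^+ i).
have c_inj : injective c.
  by move=> i j cij; case: (ltngtP i j) => // /lt_inj; case.
exfalso; apply: infinite_nat; apply: (@sub_finite_set _ _ (c @^-1` C)).
  by move=> i _; exists (x ^+ i); [exact: subgroupX|].
by apply: finite_preimage fin => i j _ _; exact: c_inj.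
Qed.
End Subgroups.

Section Translation.
Variable R : realType.

Lemma reflection_group_reflection (n : facet -> 'rV[R]_4) i (g : isom3 R) :
  is_reflection (n i) g -> reflection_group n g.
Proof. by move=> gr; apply: sub_generated_subgroup; exists i. Qed.

Lemma translation_length_ge0 (g : isom3 R) : 0 <= translation_length g.
Proof.
have [x _] := hyp3_basis R; apply: lb_le_inf.
  by exists (hdist (x ord0) (g (x ord0))); exists (x ord0).
by move=> _ [y _ <-]; exact/arcosh_ge0/lorentz_hyp3_le.
Qed.

Lemma systole_ge0 (H : set (isom3 R)) : (0 <= systole H)%E.
Proof.
by apply: le_ereal_inf_tmp => _ [g _ <-]; rewrite lee_fin translation_length_ge0.
Qed.

Lemma systole_le (H : set (isom3 R)) g x : H g -> 0 < hdist x (g x) ->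
  (forall y, hdist x (g x) <= hdist y (g y)) ->
  (systole H <= (hdist x (g x))%:E)%E.
Proof.
move=> Hg gx gmin; apply: ge_ereal_inf; exists (translation_length g)%:E.
  by exists g => //; split=> //; exists x.
rewrite lee_fin; apply: inf_lbound; last by exists x.
by exists 0 => _ [y _ <-]; exact/arcosh_ge0/lorentz_hyp3_le.
Qed.

(* The common perpendicular of the planes orthogonal to e and f is the axis of
   the product of the two reflections. *)
Lemma reflections_systole_le (H : set (isom3 R)) (e f : 'rV[R]_4) (g h : isom3 R) :
  lorentz e e = 1 -> lorentz f f = 1 -> 1 < lorentz e f ^+ 2 ->
  is_reflection e g -> is_reflection f h -> H (g * h)%g ->
  (systole H <= (arcosh (2 * lorentz e f ^+ 2 - 1))%:E)%E.
Proof.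
move=> ee ff; set s := lorentz e f => s1 ge hf Hgh.
have fe : lorentz f e = s by rewrite lorentzC.
have disp (x : hyp3 R) : - lorentz x ((g * h)%g x) =
    1 + 2 * ((lorentz x f - s * lorentz x e) ^+ 2
             + (1 - s ^+ 2) * lorentz x e ^+ 2).
  rewrite [hval ((g * h)%g x)]ge hf !lorentzBZr !lorentzBZl (hyp3P x).1 fe.
  by ring.
(* The part of [f] orthogonal to [e] is timelike because [s^2 > 1]. *)
pose y := f - s *: e.
have yy : lorentz y y = 1 - s ^+ 2.
  by rewrite /y !lorentzBZl !lorentzBZr ee ff fe -/s; ring.
have ye : lorentz y e = 0 by rewrite /y lorentzBZl ee fe; ring.
have yf : lorentz y f = 1 - s ^+ 2 by rewrite /y lorentzBZl ff -/s; ring.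
have yE x : lorentz x y = lorentz x f - s * lorentz x e.
  by rewrite /y lorentzBZr.
clearbody y.
have min_disp (x : hyp3 R) : 2 * s ^+ 2 - 1 <= - lorentz x ((g * h)%g x).
  rewrite disp; set u := lorentz x e; set v := lorentz x f.
  have xy : lorentz x y = v - s * u by exact: yE.
  (* [z] is the part of [x] orthogonal to [e] and [y]. It is orthogonal to the timelike [y], so its
     square is nonnegative, which bounds the displacement of [x] from below. *)
  pose z := hval x - u *: e - ((v - s * u) / (1 - s ^+ 2)) *: y.
  have s0 : 1 - s ^+ 2 != 0 by rewrite lt_eqF// subr_lt0.
  have zy : lorentz z y = 0.
    by rewrite /z !lorentzBZl yy xy (lorentzC e) ye mulr0 subr0 divfK// subrr.
  have : 0 <= lorentz z z.
    by apply: lorentz_timelike_orthogonal zy; rewrite yy subr_lt0.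
  rewrite {2}/z lorentzBZr zy mulr0 subr0 lorentzBZr /z !lorentzBZl.
  rewrite (hyp3P x).1 -/u (lorentzC e x) -/u (lorentzC y x) xy ee ye.
  rewrite -/u mulr0 subr0 mulr1 subrr mulr0 subr0.
  have -> : (v - s * u) / (1 - s ^+ 2) * (v - s * u) =
      - ((v - s * u) ^+ 2 / (s ^+ 2 - 1)).
    by field; rewrite s0 -opprB oppr_eq0 s0.
  set w := _ / (s ^+ 2 - 1) => wE.
  have : w * (s ^+ 2 - 1) = (v - s * u) ^+ 2.
    by rewrite divfK// -opprB oppr_eq0.
  by move=> <-; nra.
have s2 : 0 < s ^+ 2 - 1 by rewrite subr_gt0.
have y0 : y ord0 ord0 != 0.
  apply: contraTneq s2 => y0; rewrite -leNgt -oppr_ge0 opprB -yy.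
  rewrite /lorentz y0 mul0r oppr0 add0r sumr_ge0// => i _.
  by rewrite -expr2 sqr_ge0.
(* The factor [r] scales [y] to the hyperboloid, its sign choosing the upper sheet. At that point
   the product with [e] vanishes and the bound is attained. *)
pose r := Num.sg (y ord0 ord0) / Num.sqrt (s ^+ 2 - 1).
have rr : r ^+ 2 = (s ^+ 2 - 1)^-1.
  by rewrite /r expr_div_n sqr_sg y0 sqr_sqrtr ?ltW// mul1r.
have xP : lorentz (r *: y) (r *: y) = -1 /\ 0 < (r *: y) ord0 ord0.
  split.
    rewrite lorentzZl lorentzZr yy mulrA -expr2 rr.
    by rewrite -[1 - _]opprB mulrN mulVf// gt_eqF.
  by rewrite mxE /r mulrAC -normrEsg divr_gt0 ?normr_gt0// sqrtr_gt0.
have dx : - lorentz (Hyp3 xP) ((g * h)%g (Hyp3 xP)) = 2 * s ^+ 2 - 1.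
  rewrite disp /= !lorentzZl ye yf mulr0 mulr0 subr0 exprMn rr.
  by field; rewrite gt_eqF.
have <- : hdist (Hyp3 xP) ((g * h)%g (Hyp3 xP)) = arcosh (2 * s ^+ 2 - 1).
  by rewrite /hdist dx.
apply: systole_le => //; rewrite /hdist dx.
  by rewrite -arcosh1 arcosh_lt//; lra.
by move=> x; apply: arcosh_le; [lra|exact: min_disp].
Qed.
End Translation.

(** * The Gram matrix of a prism *)

Section CosPiDiv.
Variable R : realType.

(** The determinant of the Gram matrix of three unit vectors with pairwise products [- a], [- b],
    [- c]. *)
Definition gram_det (a b c : R) : R :=
  1 - a ^+ 2 - b ^+ 2 - c ^+ 2 - 2 * (a * b * c).

Lemma pi_div_itv n : (0 < n)%N -> pi / n%:R \in `[0 : R, pi].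
Proof.
move=> n0; rewrite in_itv/= divr_ge0 ?pi_ge0 ?ler0n//=.
by rewrite ler_pdivrMr ?ltr0n// ler_peMr ?pi_ge0// ler1n.
Qed.

Lemma cos_pi_div_lt m n : (0 < m < n)%N ->
  cos (pi / m%:R) < cos (pi / n%:R) :> R.
Proof.
move=> /andP[m0 mn]; have n0 := ltn_trans m0 mn.
rewrite ltr_cos ?pi_div_itv// ltr_pM2l ?pi_gt0//.
by rewrite ltf_pV2 ?posrE ?ltr0n// ltr_nat.
Qed.

Lemma cos_pi_div_le m n : (0 < m <= n)%N ->
  cos (pi / m%:R) <= cos (pi / n%:R) :> R.
Proof.
move=> /andP[m0]; rewrite leq_eqVlt => /orP[/eqP ->//|mn].
by rewrite ltW// cos_pi_div_lt ?m0.
Qed.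

Lemma cos_pi_div_ge0 n : (2 <= n)%N -> 0 <= cos (pi / n%:R) :> R.
Proof. by move=> n2; rewrite -cos_pihalf cos_pi_div_le. Qed.

Lemma cos_pi_div_gt0 n : (3 <= n)%N -> 0 < cos (pi / n%:R) :> R.
Proof. by move=> n2; rewrite -cos_pihalf cos_pi_div_lt. Qed.

Lemma cos_pi_div_sqr_lt1 n : (2 <= n)%N -> cos (pi / n%:R) ^+ 2 < 1 :> R.
Proof.
move=> n2; rewrite expr_lt1 ?cos_pi_div_ge0//.
rewrite (lt_le_trans (@cos_pi_div_lt n n.+1 _)) ?cos_le1// ltnS leqnn andbT.
exact: ltn_trans n2.
Qed.

Lemma cos_pi_div3 : cos (pi / 3) = 1 / 2 :> R.
Proof.
have c0 : 0 < cos (pi / 3) :> R := cos_pi_div_gt0 (leqnn 3).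
have : cos (pi / 3 *+ 2 + pi / 3) = -1 :> R.
  by rewrite -cospi; congr cos; rewrite mulr2n; field.
rewrite cosD cos_mulr2n sin_mulr2n.
rewrite (_ : _ - _ = 2 * cos (pi / 3) ^+ 3 - cos (pi / 3)
   - 2 * cos (pi / 3) * sin (pi / 3) ^+ 2); last by rewrite !mulr2n; ring.
rewrite sin2cos2 => h.
(* The triple angle formula with [cos pi = -1] factors in this way. *)
have : (cos (pi / 3) + 1) * (2 * cos (pi / 3) - 1) ^+ 2 = 0 :> R.
  by rewrite (_ : _ * _ = 4 * cos (pi / 3) ^+ 3 - 3 * cos (pi / 3) + 1); [lra|ring].
move/eqP; rewrite mulf_eq0 gt_eqF ?addr_gt0//= sqrf_eq0 => /eqP; lra.
Qed.

Lemma cos_pi_div6_sqr : cos (pi / 6) ^+ 2 = 3 / 4 :> R.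
Proof.
have := cos_mulr2n (pi / 6 : R).
rewrite (_ : pi / 6 *+ 2 = pi / 3); last by rewrite mulr2n; field.
by rewrite cos_pi_div3 -mulr_natl; lra.
Qed.

(** As [m > 6], [c^2] exceeds [cos(pi/6)^2 = 3/4], while [a] or [b] is at least [1/2]; so two of the
    squares already sum to more than 1. *)
Lemma gram_det_lt0 k l m : (2 <= k)%N -> (2 <= l)%N -> (k, l) <> (2, 2)%N ->
  (7 <= m)%N ->
  gram_det (cos (pi / k%:R)) (cos (pi / l%:R)) (cos (pi / m%:R)) < 0.
Proof.
move=> k2 l2 kl m7; rewrite /gram_det.
set a := cos _; set b := cos _; set c := cos _.
have a0 : 0 <= a by exact: cos_pi_div_ge0.
have b0 : 0 <= b by exact: cos_pi_div_ge0.
have c0 : 0 <= c by apply: cos_pi_div_ge0; exact: leq_trans m7.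
have c2 : 3 / 4 < c ^+ 2.
  rewrite -cos_pi_div6_sqr ltr_pXn2r ?nnegrE//; first exact: cos_pi_div_lt.
  exact: cos_pi_div_ge0.
have abc : 0 <= a * b * c by rewrite !mulr_ge0.
have ab : 1 / 2 <= a \/ 1 / 2 <= b.
  have [k3|k3] := leqP 3 k; first by left; rewrite -cos_pi_div3 cos_pi_div_le.
  have [l3|l3] := leqP 3 l; first by right; rewrite -cos_pi_div3 cos_pi_div_le.
  by case: kl; congr pair; apply/eqP; rewrite eqn_leq ?k2 ?l2 -ltnS ?k3 ?l3.
have := sqr_ge0 a; have := sqr_ge0 b; case: ab => h; nra.
Qed.
End CosPiDiv.

Section Gram.
Variable R : realType.
Implicit Types n : facet -> 'rV[R]_4.

Record prism_gram n (a b c p : R) : Prop := PrismGram {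
  gram_unit : forall i, lorentz (n i) (n i) = 1 ;
  gram12 : lorentz (n F1) (n F2) = - a ;
  gram13 : lorentz (n F1) (n F3) = - b ;
  gram23 : lorentz (n F2) (n F3) = - c ;
  gramB1 : lorentz (n Bot) (n F1) = 0 ;
  gramB2 : lorentz (n Bot) (n F2) = 0 ;
  gramB3 : lorentz (n Bot) (n F3) = 0 ;
  gramT1 : lorentz (n Top) (n F1) = - p ;
  gramT2 : lorentz (n Top) (n F2) = 0 ;
  gramT3 : lorentz (n Top) (n F3) = 0 }.

Lemma dihedral_angle_lorentz (e f : 'rV[R]_4) q : (2 <= q)%N ->
  dihedral_angle e f = pi / q%:R -> lorentz e f = - cos (pi / q%:R).
Proof.
rewrite /dihedral_angle => q2 ef.
have q0 : (0 < q)%N by exact: ltn_trans q2.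
have acosE : acos (lorentz e f) = pi - pi / q%:R by rewrite -ef opprB addrC subrK.
have pq : pi / q%:R < pi :> R.
  by rewrite ltr_pdivrMr ?ltr0n// ltr_pMr ?pi_gt0// ltr1n.
(* Outside its domain [acos] takes the default value 0. That would make the angle [pi], which
   differs from [pi / q] for [q >= 2]. *)
have : [set y | 0 <= y <= pi /\ cos y = lorentz e f] (acos (lorentz e f)).
  move: acosE; rewrite unlock; case: xgetP => // _ zero.
  by move: pq; rewrite -subr_gt0 -zero ltxx.
by rewrite acosE => -[_ <-]; rewrite cosB cospi sinpi mul0r addr0 mulN1r.
Qed.

Lemma coxeter_prism_gram j k l m n : (2 <= k)%N -> (2 <= l)%N -> (2 <= m)%N ->
  is_coxeter_prism j k l m n ->
  prism_gram n (cos (pi / k%:R)) (cos (pi / l%:R)) (cos (pi / m%:R))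
    (cos (pi / (p_ j)%:R)).
Proof.
move=> k2 l2 m2 [u _ _ _ h12 h13 h23 hB1 hB2 hB3 hT1 hT2 hT3 _].
have half e f : dihedral_angle e f = pi / 2 -> lorentz e f = 0 :> R.
  by move/(dihedral_angle_lorentz (leqnn 2)); rewrite cos_pihalf oppr0.
split=> //; try (by apply: half); apply: dihedral_angle_lorentz => //.
by case: (j) => [|[|[|]]].
Qed.

Definition basis_facet (i : 'I_4) : facet := nth Bot [:: F1; F2; F3] i.

Definition gram_basis n : 'M[R]_4 := \matrix_i n (basis_facet i).

Section GramBasis.
Variables (n : facet -> 'rV[R]_4) (a b c p : R).
Hypotheses (nG : prism_gram n a b c p).
Let d := gram_det a b c.

Lemma mul_gram_basis (v : 'rV[R]_4) : exists x1 x2 x3 y,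
  [/\ v *m gram_basis n =
      x1 *: n F1 + x2 *: n F2 + x3 *: n F3 + y *: n Bot &
      x1 = 0 -> x2 = 0 -> x3 = 0 -> y = 0 -> v = 0].
Proof.
pose i1 : 'I_4 := lift ord0 ord0; pose i2 : 'I_4 := lift ord0 (lift ord0 ord0).
pose i3 : 'I_4 := lift ord0 (lift ord0 (lift ord0 ord0)).
exists (v ord0 ord0), (v ord0 i1), (v ord0 i2), (v ord0 i3); split.
  by rewrite mulmx_sum_row !big_ord_recl big_ord0 !rowK addr0 !addrA.
move=> v0 v1 v2 v3; apply/rowP => i; rewrite mxE.
case: i => -[|[|[|[|//]]]] ilt; [rewrite -v0|rewrite -v1|rewrite -v2|rewrite -v3];
  by congr (v _ _); apply: val_inj.
Qed.

Let lorentz_comb w x1 x2 x3 y :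
  w = x1 *: n F1 + x2 *: n F2 + x3 *: n F3 + y *: n Bot ->
  [/\ lorentz w (n F1) = x1 - a * x2 - b * x3,
      lorentz w (n F2) = - a * x1 + x2 - c * x3,
      lorentz w (n F3) = - b * x1 - c * x2 + x3 &
      lorentz w (n Bot) = y].
Proof.
case: nG => u h12 h13 h23 hB1 hB2 hB3 _ _ _.
move=> ->; rewrite !lorentzDl !lorentzZl !u hB1 hB2 hB3 !(lorentzC (n F2)) !(lorentzC (n F3)).
rewrite ?(lorentzC _ (n F1)) ?(lorentzC _ (n Bot)) ?(lorentzC (n F3) (n F2)).
by rewrite h12 h13 h23 hB1 hB2 hB3; split; ring.
Qed.

Lemma gram_basis_unit : d != 0 -> gram_basis n \in unitmx.
Proof.
move=> d0; rewrite -row_free_unit; apply: inj_row_free => v.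
have [x1 [x2 [x3 [y [-> v0]]]]] := mul_gram_basis v => /esym/lorentz_comb[].
rewrite !lorentz0l => e1 e2 e3 e4.
have dI x : d * x = 0 -> x = 0 by move/eqP; rewrite mulf_eq0 (negbTE d0) => /eqP.
apply: v0 => //; apply: dI; rewrite /d /gram_det.
(* The coefficients in the three cases are the rows of the adjugate of the Gram matrix, as in
   Cramer's rule. *)
- transitivity ((1 - c ^+ 2) * (x1 - a * x2 - b * x3)
    + (a + b * c) * (- a * x1 + x2 - c * x3)
    + (b + a * c) * (- b * x1 - c * x2 + x3)); first by ring.
  by rewrite -e1 -e2 -e3; ring.
- transitivity ((a + b * c) * (x1 - a * x2 - b * x3)
    + (1 - b ^+ 2) * (- a * x1 + x2 - c * x3)
    + (c + a * b) * (- b * x1 - c * x2 + x3)); first by ring.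
  by rewrite -e1 -e2 -e3; ring.
- transitivity ((b + a * c) * (x1 - a * x2 - b * x3)
    + (c + a * b) * (- a * x1 + x2 - c * x3)
    + (1 - a ^+ 2) * (- b * x1 - c * x2 + x3)); first by ring.
  by rewrite -e1 -e2 -e3; ring.
Qed.

(** In the basis of the other four normals, Cramer's rule gives the coefficient [x1] of [n Top]
    along [n F1], and the coefficient [y] along [n Bot] is the wanted product. Then [n Top] having
    square 1 reads [1 = - p x1 + y^2]. *)
Lemma gram_base_product : d != 0 ->
  lorentz (n Bot) (n Top) ^+ 2 = 1 - p ^+ 2 * (1 - c ^+ 2) / d.
Proof.
move=> d0; have NU := gram_basis_unit d0.
have [x1 [x2 [x3 [y [TE _]]]]] := mul_gram_basis (n Top *m invmx (gram_basis n)).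
rewrite mulmxKV// in TE.
have := lorentz_comb TE.
case: nG => u _ _ _ _ _ _ hT1 hT2 hT3 []; rewrite hT1 hT2 hT3 => e1 e2 e3 e4.
have : lorentz (n Top) (n Top) = - p * x1 + y ^+ 2.
  rewrite {1}TE !lorentzDl !lorentzZl !(lorentzC _ (n Top)) hT1 hT2 hT3 e4.
  by ring.
rewrite u lorentzC e4 => uu.
have x1E : d * x1 = - p * (1 - c ^+ 2).
  transitivity ((1 - c ^+ 2) * (x1 - a * x2 - b * x3)
    + (a + b * c) * (- a * x1 + x2 - c * x3)
    + (b + a * c) * (- b * x1 - c * x2 + x3)); first by rewrite /d /gram_det; ring.
  by rewrite -e1 -e2 -e3; ring.
have -> : y ^+ 2 = 1 + p * x1 by lra.
by congr (_ + _); apply: (mulfI d0); rewrite mulrCA x1E; field.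
Qed.
End GramBasis.
End Gram.

(** * Products of two reflections *)

(** The coding makes [facet] a finite type, so that the Gram entries can be listed. *)
Definition facet_code (i : facet) : 'I_5 :=
  match i with F1 => inord 0 | F2 => inord 1 | F3 => inord 2
  | Bot => inord 3 | Top => inord 4 end.

Definition facet_decode (i : 'I_5) : facet := nth F1 [:: F1; F2; F3; Bot; Top] i.

Lemma facet_codeK : cancel facet_code facet_decode.
Proof. by case; rewrite /facet_decode inordK. Qed.

HB.instance Definition _ := Countable.copy facet (can_type facet_codeK).
HB.instance Definition _ := Finite.copy facet (can_type facet_codeK).

Section Reflections.
Variable R : realType.
Implicit Types (e f v : 'rV[R]_4) (g h : isom3 R).

Lemma reflectionV e g : lorentz e e = 1 -> is_reflection e g -> (g^-1)%g = g.
Proof.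
move=> ee ge; apply: mulg1_eq; apply: isom_mx_inj; rewrite isom_mxM isom_mx1.
apply: hyp3_mx_ext => x; rewrite mulmxA mulmx1 !(reflection_mxE _ ge).
rewrite lorentzBZl ee; apply/rowP => i; rewrite !mxE; ring.
Qed.

Lemma reflections_mulmx e f g h v : is_reflection e g -> is_reflection f h ->
  v *m isom_mx (g * h)%g = v - (2 * lorentz v f) *: f
    - (2 * (lorentz v e - 2 * lorentz v f * lorentz f e)) *: e.
Proof.
move=> ge hf; rewrite isom_mxM mulmxA (reflection_mxE _ hf).
by rewrite (reflection_mxE _ ge) lorentzBZl.
Qed.

Lemma reflections_order e f g h m : (2 <= m)%N ->
  lorentz e e = 1 -> lorentz f f = 1 -> lorentz e f = - cos (pi / m%:R) ->
  is_reflection e g -> is_reflection f h -> ((g * h) ^+ m)%g = 1%g.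
Proof.
move=> m2 ee ff ef ge hf; set th := pi / m%:R in ef.
have m0 : m%:R != 0 :> R by rewrite pnatr_eq0 -lt0n (ltn_trans _ m2).
have c1 : cos th ^+ 2 < 1 by exact: cos_pi_div_sqr_lt1.
have ss : sin th ^+ 2 = 1 - cos th ^+ 2 := sin2cos2 th.
have s0 : sin th != 0 by rewrite -sqrf_eq0 ss gt_eqF ?subr_gt0.
apply: isom_mx_inj; rewrite isom_mx1 isom_mxX; apply: hyp3_mx_ext => z.
move: (hval z) => {z} v; rewrite mulmx1; set A := isom_mx _.
(* The product is a rotation by [2 th] in the plane of [e] and [f]. The products with [e] and [f]
   are multiplied by [sin th] to avoid division. *)
have /(_ m) [x [y [vE]]] : forall i, exists x y, [/\
    v *m A ^+ i = v + x *: e + y *: f,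
    sin th * lorentz (v *m A ^+ i) e =
      - lorentz v f * sin (i%:R * (2 * th))
      - lorentz v e * sin (i%:R * (2 * th) - th) &
    sin th * lorentz (v *m A ^+ i) f =
      lorentz v f * sin (i%:R * (2 * th) + th)
      + lorentz v e * sin (i%:R * (2 * th))].
  elim=> [|i [x [y [vE pE qE]]]].
    exists 0, 0; rewrite mulmx1 !scale0r !addr0 mul0r sub0r add0r sin0 sinN.
    by split=> //; ring.
  have iE : i.+1%:R * (2 * th) = i%:R * (2 * th) + 2 * th.
    by rewrite -(natr1 i); ring.
  rewrite exprSr -[_ * A]/(_ *m A) mulmxA (reflections_mulmx _ ge hf).
  set w := v *m A ^+ i in vE pE qE *.
  set P := lorentz w e in pE *; set Q := lorentz w f in qE *.
  exists (x - 2 * (P - 2 * Q * lorentz f e)), (y - 2 * Q); split.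
  - by rewrite vE; apply/rowP => k; rewrite !mxE; ring.
  - rewrite !lorentzBZl ee (lorentzC f e) ef -/P.
    transitivity (- (sin th * P) - 2 * cos th * (sin th * Q)); first by ring.
    rewrite pE qE iE; set ph := i%:R * (2 * th).
    rewrite (_ : ph + 2 * th - th = ph + th); last by ring.
    rewrite (_ : ph + 2 * th = ph + th + th); last by ring.
    rewrite ?sinB !(sinD, cosD); ring: ss.
  - rewrite !lorentzBZl ff (lorentzC f e) ef -/P -/Q.
    transitivity (2 * cos th * (sin th * P)
      + (4 * cos th ^+ 2 - 1) * (sin th * Q)); first by ring.
    rewrite pE qE iE; set ph := i%:R * (2 * th).
    rewrite (_ : ph + 2 * th = ph + th + th); last by ring.
    rewrite ?sinB !(sinD, cosD); ring: ss.
(* After [m] steps the angle is a full turn, so both products return to their initial values. As [e]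
   and [f] are independent, this forces [x] and [y] to vanish. *)
have -> : m%:R * (2 * th) = pi *+ 2 by rewrite mulr2n /th; field.
rewrite [sin (_ - th)]sinB [sin (_ + th)]sinD sin2pi cos2pi => pE qE.
have : lorentz (v *m A ^+ m) e = lorentz v e.
  by apply: (mulfI s0); rewrite pE; ring.
have : lorentz (v *m A ^+ m) f = lorentz v f.
  by apply: (mulfI s0); rewrite qE; ring.
rewrite vE !lorentzDl !lorentzZl ee ff (lorentzC f e) ef => yE xE.
have {xE}xE : x = cos th * y by lra.
have y0 : (1 - cos th ^+ 2) * y = 0 by move: yE; rewrite xE; lra.
move/eqP: y0; rewrite mulf_eq0 gt_eqF ?subr_gt0//= => /eqP y0.
by rewrite xE y0 mulr0 !scale0r !addr0.
Qed.

Lemma reflections_fixed e f g h v :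
  lorentz e e = 1 -> lorentz f f = 1 -> lorentz e f ^+ 2 < 1 ->
  is_reflection e g -> is_reflection f h ->
  v *m isom_mx (g * h)%g = v -> lorentz v e = 0 /\ lorentz v f = 0.
Proof.
move=> ee ff ef ge hf; rewrite (reflections_mulmx _ ge hf) => vE.
have := congr1 (lorentz e) vE; have := congr1 (lorentz f) vE.
rewrite !lorentzBZr ee ff (lorentzC f e) (lorentzC e v) (lorentzC f v).
move: (lorentz v e) (lorentz v f) (lorentz e f) ef => p q s s1 h1 h2.
have pE : p = s * q by lra.
have /eqP : (1 - s ^+ 2) * q = 0 by rewrite pE in h1; lra.
rewrite mulf_eq0 gt_eqF ?subr_gt0//= => /eqP q0.
by rewrite pE q0 mulr0.
Qed.

Lemma reflections_iter e f g h i :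
  lorentz e e = 1 -> lorentz f f = 1 -> 1 < lorentz e f ^+ 2 ->
  is_reflection e g -> is_reflection f h -> (0 < i)%N ->
  exists x y, y != 0 /\ e *m isom_mx ((g * h) ^+ i)%g = x *: e + y *: f.
Proof.
move=> ee ff s1 ge hf; rewrite isom_mxX; set A := isom_mx _.
set s := lorentz e f in s1.
(* The invariant uses [- s * y] since the sign of [s] is not fixed; [s^2 > 1] preserves it. *)
suff [x [y [Ae x0 /andP[y0 yx] yi]]] : exists x y,
    [/\ e *m A ^+ i = x *: e + y *: f, 0 < x, 0 <= - s * y <= x &
        (0 < i)%N -> 0 < - s * y].
  move=> i0; exists x, y; split=> //.
  by apply: contraTneq (yi i0) => ->; rewrite mulr0 ltxx.
elim: i => [|i [x [y [Ae x0 /andP[y0 yx] _]]]].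
  exists 1, 0; split; rewrite ?mulr0 ?lexx ?ler01 ?ltr01 ?ltxx//.
  by rewrite mulmx1 scale1r scale0r addr0.
exists ((4 * s ^+ 2 - 1) * x + 2 * s * y), (- 2 * s * x - y).
rewrite exprSr -[_ * A]/(_ *m A) mulmxA Ae (reflections_mulmx _ ge hf).
rewrite !lorentzDl !lorentzZl ee ff (lorentzC f e) -/s; split.
- by apply/rowP => k; rewrite !mxE; ring.
- by nra.
- by apply/andP; split; nra.
- by nra.
Qed.

(* The rotation fixes the normal of Bot, so if it commuted with u then it would
   also fix the image of that normal under u, which would then be orthogonal to
   n F2 and n F3; but this image has a nonzero component along n F1. *)
Lemma rotation_not_commute n a b c p (r1 r2 r3 rB rT : isom3 R) i :
  prism_gram n a b c p -> c ^+ 2 < 1 -> p != 0 -> (a != 0) || (b != 0) ->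
  1 < lorentz (n Bot) (n Top) ^+ 2 ->
  is_reflection (n F1) r1 -> is_reflection (n F2) r2 -> is_reflection (n F3) r3 ->
  is_reflection (n Bot) rB -> is_reflection (n Top) rT -> (0 < i)%N ->
  let u := (((rB * rT) ^ r1) ^+ i)%g in (r2 * r3 * u)%g <> (u * (r2 * r3))%g.
Proof.
move=> [un h12 h13 h23 hB1 hB2 hB3 hT1 hT2 hT3] c1 p0 ab s1 f1 f2 f3 fB fT i0 u.
have [x [y [y0 BE]]] := reflections_iter (un _) (un _) s1 fB fT i0.
(* The reflection [r1] fixes [n Bot] and sends [n Top] to [n Top + 2 p n F1]; conjugation by it
   creates the component along [n F1]. *)
have Bu : n Bot *m isom_mx u = x *: n Bot + y *: n Top + (2 * y * p) *: n F1.
  rewrite /u -conjXg /conjg !isom_mxM (reflectionV (un F1) f1) !mulmxA.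
  rewrite (reflection_mxE (n Bot) f1) hB1 mulr0 scale0r subr0 BE.
  rewrite (reflection_mxE _ f1).
  rewrite lorentzDl !lorentzZl hB1 hT1; apply/rowP => k; rewrite !mxE; ring.
have Br : n Bot *m isom_mx (r2 * r3)%g = n Bot.
  by rewrite (reflections_mulmx _ f2 f3) hB2 hB3 !(mulr0, mul0r, subr0, scale0r).
move=> /(congr1 (fun f : isom3 R => n Bot *m isom_mx f)).
rewrite (isom_mxM (r2 * r3)%g u) (isom_mxM u) !mulmxA Br => ur.
have := reflections_fixed (un _) (un _) _ f2 f3 ur; rewrite h23 sqrrN => /(_ c1).
rewrite Bu !lorentzDl !lorentzZl hB2 hT2 h12 hB3 hT3 h13 !mulr0 !add0r.
move=> [/eqP ha /eqP hb]; move: ab ha hb.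
rewrite !mulf_eq0 !oppr_eq0 (negbTE p0) (negbTE y0) pnatr_eq0/=.
by case: (a == 0) (b == 0) => -[].
Qed.
End Reflections.

(** * Rational structure and commensurability *)

Section RationalStructure.
Variable R : realType.

Lemma qspan_stable (J : finType) (w : J -> 'rV[R]_4) (A : 'M[R]_4) v :
  (forall j, qspan w (w j *m A)) -> qspan w v -> qspan w (v *m A).
Proof.
move=> wA [q ->]; rewrite mulmx_suml; apply: qspan_sum => j.
by rewrite -scalemxAl; exact: qspanZ.
Qed.

Lemma reflection_group_qspan (n : facet -> 'rV[R]_4) :
  (forall i, lorentz (n i) (n i) = 1) -> gram_basis n \in unitmx ->
  (forall i j, algebraicOver (ratr : rat -> R) (lorentz (n i) (n j))) ->
  exists (J : finType) (w : J -> 'M[R]_4),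
    forall f : isom3 R, reflection_group n f -> qspan w (isom_mx f).
Proof.
move=> nu NU nalg.
pose s := [seq lorentz (n ij.1) (n ij.2) | ij : facet * facet].
have [|I [e [[e1 eM] es]]] := @seq_algebraic_qring _ s.
  by move=> _ /mapP[ij _ ->].
(* This family spans the module generated by all five normals over the ring spanned by [e]. *)
pose w (ij : I * facet) := e ij.1 *: n ij.2.
have Kn (x : R) b : qspan (e : I -> R^o) x -> qspan w (x *: n b).
  move=> [q ->]; rewrite scaler_suml; apply: qspan_sum => i.
  by rewrite -scalerA; apply: qspanZ; exact: (qspan_id w (i, b)).
have wn b : qspan w (n b) by rewrite -[n b]scale1r; exact: Kn.
have w_refl i (f : isom3 R) v : is_reflection (n i) f ->
    qspan w v -> qspan w (v *m isom_mx f).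
  move=> fi; apply: qspan_stable => -[k b].
  rewrite (reflection_mxE _ fi) lorentzZl /w/=; apply: qspanD.
    by apply: Kn; exact: (qspan_id (e : I -> R^o)).
  rewrite -scaleNr -mulNr (_ : - 2 = ratr (- 2%:R)); last first.
    by rewrite rmorphN rmorph_nat.
  rewrite -scalerA; apply: qspanZ; apply: Kn; apply: eM.
    exact: (qspan_id (e : I -> R^o)).
  by apply: es; apply/mapP; exists (b, i); rewrite ?mem_enum.
have w_group (f : isom3 R) : reflection_group n f ->
    forall v, qspan w v -> qspan w (v *m isom_mx f).
  (* Stability is imposed on [f] and its inverse together, which makes [H] a subgroup. *)
  pose H := [set f : isom3 R | forall v, qspan w v ->
    qspan w (v *m isom_mx f) /\ qspan w (v *m isom_mx f^-1%g)].
  suff : reflection_group n `<=` H by move=> /[apply] Hf v /Hf[].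
  move=> {}f; apply; split=> [|g [i gi] v wv]; last first.
    by rewrite (reflectionV (nu i) gi); split; exact: w_refl gi wv.
  split=> [v|g h Hg Hh v wv]; first by rewrite invg1 isom_mx1 mulmx1.
  rewrite invgF !isom_mxM !mulmxA.
  by split; [apply: (Hg _ (Hh _ wv).2).1|apply: (Hh _ (Hg _ wv).2).1].
(* [L a] puts a vector in row [a] and multiplies by the inverse basis matrix, so a matrix is
   recovered from the images of the four basis normals. *)
pose L (a : 'I_4) : {linear 'rV[R]_4 -> 'M[R]_4} :=
  mulmx (invmx (gram_basis n) *m delta_mx a ord0).
exists _, (fun aj : 'I_4 * (I * facet) => L aj.1 (w aj.2)) => f nf.
have -> : isom_mx f = \sum_a L a (row a (gram_basis n *m isom_mx f)).
  rewrite /L/=; under eq_bigr do rewrite -mulmxA.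
  rewrite -mulmx_sumr -[LHS](mulKmx NU); congr (_ *m _).
  apply/matrixP => i j; rewrite summxE (bigD1 i)//= big1 => [|a ai].
    by rewrite !mxE big_ord1 !mxE !eqxx mul1r addr0.
  by rewrite mxE big_ord1 !mxE eq_sym (negbTE ai) mul0r.
apply: qspan_sum_linear => a; rewrite row_mul rowK; exact: w_group.
Qed.

(* If [m - 1 > #|J|] then the conjugates of u by the powers of t satisfy a
   rational relation shorter than the m-th cyclotomic polynomial. *)
Lemma conj_period_rational (J : finType) (w : J -> 'M[R]_4) m (t u : isom3 R) :
  prime m -> (#|J| < m.-1)%N -> (t ^+ m = 1)%g ->
  (forall i, (i < m.-1)%N -> qspan w (isom_mx (u ^ (t^-1 ^+ i))%g)) ->
  (u ^ t^-1 = u)%g.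
Proof.
move=> pm Jm tm wX.
have [q [q0 qm qX]] := qspan_dependent Jm wX.
(* [C] is conjugation by [t] on flattened matrices. Its size is read below as [15.+1], for which
   square matrices form a ring. *)
pose C : 'M[R]_(4 * 4) :=
  lin_mx (mulmxr (isom_mx t) \o mulmx (isom_mx t^-1%g)).
have CE f : mxvec (isom_mx f) *m C = mxvec (isom_mx (f ^ t^-1)%g).
  by rewrite mul_vec_lin /= /conjg invgK !isom_mxM.
have CX i : mxvec (isom_mx u) *m (C : 'M[R]_(15.+1)) ^+ i =
    mxvec (isom_mx (u ^ (t^-1 ^+ i))%g).
  elim: i => [|i IHi]; first by rewrite mulmx1 conjg1.
  by rewrite exprSr -[_ * C]/(_ *m C) mulmxA IHi CE expgSr conjgM.
have : mxvec (isom_mx u) *m C = mxvec (isom_mx u).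
  apply: (@prime_period_rational_relation R 15 C _ m q) => //.
    by rewrite CX expVgn tm invg1 conjg1.
  have X0 := congr1 (@mxvec R 4 4) qX; rewrite linear_sum linear0 in X0.
  apply: etrans X0; apply: eq_bigr => i _.
  by rewrite CX linearZ.
by rewrite CE => /(can_inj mxvecK)/isom_mx_inj.
Qed.

(** The bound depends only on [H], so one commensurability class meets the sequence in finitely many
    prime values of [m]. *)
Lemma commensurable_prime_bound (H : set (isom3 R)) (J : finType)
    (w : J -> 'M[R]_4) n a b p m :
  is_subgroup H -> (forall f, H f -> qspan w (isom_mx f)) ->
  prism_gram n a b (cos (pi / m%:R)) p -> p != 0 -> (a != 0) || (b != 0) ->
  1 < lorentz (n Bot) (n Top) ^+ 2 -> prime m ->
  commensurable H (reflection_group n) -> (m.-1 <= #|J|)%N.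
Proof.
move=> sH Hw nG p0 ab s1 pm [g [_]]; set K := conj_subgroup g _ => fin.
have m2 := prime_gt1 pm; have nu := gram_unit nG.
rewrite leqNgt; apply/negP => Jm.
have sG : is_subgroup (reflection_group n) := generated_subgroup_subgroup _.
have sK : is_subgroup K := conj_subgroup_subgroup g sG.
have sHK := subgroupI sH sK.
have refl i := reflection_exists (nu i).
have [r1 f1] := refl F1; have [r2 f2] := refl F2; have [r3 f3] := refl F3.
have [rB fB] := refl Bot; have [rT fT] := refl Top.
have G1 := reflection_group_reflection f1.
have G2 := reflection_group_reflection f2.
have G3 := reflection_group_reflection f3.
have GB := reflection_group_reflection fB.
have GT := reflection_group_reflection fT.
have KJ x : reflection_group n x -> K (x ^ g^-1)%g.
  by move=> Gx; exists x => //; rewrite /conjg invgK mulgA.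
pose r := (r2 * r3)%g; pose h := ((rB * rT) ^ r1)%g.
have Kt : K (r ^ g^-1)%g by apply: KJ; exact: (subgroupM sG G2 G3).
have Ky : K (h ^ g^-1)%g.
  apply: KJ; apply: (subgroupM sG (subgroupV sG G1)).
  exact: (subgroupM sG (subgroupM sG GB GT) G1).
set t := (r ^ g^-1)%g in Kt; set y := (h ^ g^-1)%g in Ky.
have /choice[N NP] : forall i, exists k, (0 < k)%N /\
    (H `&` K) ((y ^ (t^-1 ^+ i)) ^+ k)%g.
  move=> i; have [|k k0 Hk] := finite_index_expg sHK sK fin (x := (y ^ (t^-1 ^+ i))%g).
    have Kti : K (t^-1 ^+ i)%g by exact: (subgroupX _ sK (subgroupV sK Kt)).
    exact: (subgroupM sK (subgroupV sK Kti) (subgroupM sK Ky Kti)).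
  by exists k.
(* The product is a single exponent that works for all conjugates. *)
pose M := (\prod_(i < m) N i)%N.
have M0 : (0 < M)%N by apply: prodn_gt0 => i; exact: (NP i).1.
have : ((y ^+ M) ^ t^-1 = y ^+ M)%g.
  apply: (conj_period_rational (w := w) pm Jm).
    rewrite /t -conjXg (reflections_order m2 (nu _) (nu _) (gram23 nG) f2 f3).
    exact: conj1g.
  move=> i im; apply: Hw; rewrite conjXg /M.
  have im' : (i < m)%N by rewrite (leq_trans im)// leq_pred.
  rewrite (bigD1 (Ordinal im'))//= expgnA.
  by apply: (subgroupX _ sHK (NP i).2).1.
(* Removing the conjugation by [g] turns this into a commutation inside the group of the prism. *)
rewrite /y -conjXg /t -conjVg -conjJg => /conjg_inj hr.
have := rotation_not_commute nG (cos_pi_div_sqr_lt1 R m2) p0 ab s1 f1 f2 f3 fB fT M0.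
apply; rewrite -/h -/r; apply: esym.
rewrite -[in LHS]hr /conjg invgK.
by rewrite -mulgA mulgVK.
Qed.
End RationalStructure.

(** * The sequence of prisms *)

Section PrismSequence.
Variable R : realType.

(** The extreme case is [1/2 + 1/3 + 1/7 = 41/42]. *)
Lemma admissible_ge7 k l m : (2 <= k)%N -> (2 <= l)%N -> (k, l) <> (2, 2)%N ->
  (7 <= m)%N -> admissible k l m.
Proof.
move=> k2 l2 kl m7; split; first exact: leq_trans m7.
have inv_le i j : (0 < i)%N -> (i <= j)%N -> j%:R^-1 <= i%:R^-1 :> rat.
  move=> i0 ij; rewrite lef_pV2 ?posrE ?ltr0n// ?ler_nat//.
  exact: leq_trans ij.
have := inv_le 2 k isT k2; have := inv_le 2 l isT l2; have := inv_le 7 m isT m7.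
have [k3|k3] := leqP 3 k; first by have := inv_le 3 k isT k3; lra.
have [l3|l3] := leqP 3 l; first by have := inv_le 3 l isT l3; lra.
by case: kl; congr pair; apply/eqP; rewrite eqn_leq ?k2 ?l2 -ltnS ?k3 ?l3.
Qed.

Lemma cvg_cos_pi_div : cos (pi / m%:R) @[m --> \oo] --> (1 : R).
Proof.
have h : pi / m%:R @[m --> \oo] --> (pi * 0 : R).
  rewrite -cvg_shiftS /=.
  by apply: cvgM; [exact: cvg_cst|exact: cvg_harmonic].
rewrite mulr0 in h.
by have := cvg_comp _ _ h (@continuous_cos R 0); rewrite cos0.
Qed.

(** Up to sign all entries are 0, 1 or one of [a], [b], [c], [p], except the product for [Bot] and
    [Top], whose square is a rational function of these. *)
Lemma prism_gram_algebraic (n : facet -> 'rV[R]_4) a b c p :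
  prism_gram n a b c p -> gram_det a b c != 0 ->
  (forall x, x \in [:: a; b; c; p] -> algebraicOver (ratr : rat -> R) x) ->
  forall i j, algebraicOver (ratr : rat -> R) (lorentz (n i) (n j)).
Proof.
move=> nG d0 alg.
have aA : algebraicOver ratr a by apply: alg; rewrite !inE eqxx.
have bA : algebraicOver ratr b by apply: alg; rewrite !inE eqxx !orbT.
have cA : algebraicOver ratr c by apply: alg; rewrite !inE eqxx !orbT.
have pA : algebraicOver ratr p by apply: alg; rewrite !inE eqxx !orbT.
have one := algebraic1 (ratr : rat -> R).
have sqA x : algebraicOver ratr x -> algebraicOver ratr (x ^+ 2 : R).
  by move=> xA; exact: algebraic_mul.
have BT : algebraicOver ratr (lorentz (n Bot) (n Top)).
  apply: algebraic_sqr; rewrite (gram_base_product nG d0).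
  apply: algebraic_sub => //; apply: algebraic_div.
    by apply: algebraic_mul; [exact: sqA|apply: algebraic_sub => //; exact: sqA].
  rewrite /gram_det; do 4?[apply: algebraic_sub] => //; try exact: sqA.
  rewrite mulr_natl mulr2n; apply: algebraic_add; do 2?apply: algebraic_mul => //.
case: nG => nu h12 h13 h23 hB1 hB2 hB3 hT1 hT2 hT3.
have sym i j : algebraicOver ratr (lorentz (n i) (n j)) ->
    algebraicOver ratr (lorentz (n j) (n i)) by rewrite lorentzC.
have zero := algebraic0 (ratr : rat -> R).
case; case; rewrite ?nu//; try (apply: (sym _ _); done);
  try (by rewrite ?h12 ?h13 ?h23 ?hB1 ?hB2 ?hB3 ?hT1 ?hT2 ?hT3 //; apply: algebraic_opp);
  by apply: sym; rewrite ?h12 ?h13 ?h23 ?hB1 ?hB2 ?hB3 ?hT1 ?hT2 ?hT3 //; apply: algebraic_opp.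
Qed.

Lemma gram_base_product_gt1 (n : facet -> 'rV[R]_4) a b c p :
  prism_gram n a b c p -> gram_det a b c < 0 -> p != 0 -> c ^+ 2 < 1 ->
  1 < lorentz (n Bot) (n Top) ^+ 2.
Proof.
move=> nG d0 p0 c1; rewrite (gram_base_product nG) ?lt_eqF//.
rewrite ltrDl -mulrN -invrN divr_gt0 ?oppr_gt0// mulr_gt0 ?subr_gt0//.
by rewrite exprn_even_gt0.
Qed.

Lemma cvg_base_distance (a b p : R) (c : nat -> R) : 0 <= a -> 0 <= b ->
  (a != 0) || (b != 0) -> c m @[m --> \oo] --> (1 : R) ->
  (arcosh (2 * (1 - p ^+ 2 * (1 - c m ^+ 2) / gram_det a b (c m)) - 1))%:E
    @[m --> \oo] --> 0%E.
Proof.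
move=> a0 b0 ab c1; apply: cvg_EFin; first exact: nearW.
have d0 : gram_det a b 1 != 0.
  rewrite (_ : gram_det a b 1 = - (a + b) ^+ 2); last by rewrite /gram_det; ring.
  by rewrite oppr_eq0 sqrf_eq0 paddr_eq0// negb_and.
pose F m := 2 * (1 - p ^+ 2 * (1 - c m ^+ 2) / gram_det a b (c m)) - 1.
apply: (@cvg_comp _ _ _ F (@arcosh R)); last exact: cvg_arcosh1.
have cc := cvgM c1 c1.
have -> : (1 : R) = 2 * (1 - p ^+ 2 * (1 - 1 * 1) / gram_det a b 1) - 1.
  by rewrite mulr1 subrr mulr0 mul0r subr0; ring.
rewrite /F; apply: cvgB; last exact: cvg_cst.
apply: cvgM; first exact: cvg_cst.
apply: cvgB; first exact: cvg_cst.
apply: cvgM.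
  apply: cvgM; first exact: cvg_cst.
  by apply: cvgB; [exact: cvg_cst|exact: cc].
apply: cvgV => //; rewrite /gram_det.
apply: cvgB.
  by apply: cvgB; [exact: cvg_cst|exact: cc].
by do 2!(apply: cvgM; first exact: cvg_cst).
Qed.

Lemma infinite_primes_ge7 : infinite_set [set m | prime m && (7 <= m)%N].
Proof.
move=> /finite_seqP[s sE].
have [q sq pq] := prime_above (maxn 6 (\max_(i <- s) i)).
move: sq; rewrite gtn_max => /andP[q7 sq].
have : [set` s] q by rewrite -sE /= pq q7.
move=> /= qs; have : (q <= \max_(i <- s) i)%N by exact: leq_bigmax_seq.
by rewrite leqNgt sq.
Qed.
End PrismSequence.

Theorem theorem1p4 (R : realType) (j k l : nat)
  (hj : (1 <= j <= 3)%N) (hk : (2 <= k)%N) (hl : (2 <= l)%N)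
  (hkl : (k, l) <> (2, 2)%N)
  (hj1 : j = 1%N -> (k <= 5)%N /\ (l <= 5)%N)
  (hj23 : j = 2%N \/ j = 3%N -> (k <= 3)%N /\ (l <= 3)%N)
  (P : nat -> facet -> 'rV[R]_4)
  (hP : forall m : nat, admissible k l m -> is_coxeter_prism j k l m (P m)) :
  infinite_set
    [set commensurability_class (reflection_group (P m)) | m in admissible k l]
  /\ systole (reflection_group (P m)) @[m --> \oo] --> 0%E.
Proof.
have pj : (3 <= p_ j)%N by case: (j) => [|[|[|]]].
have p0 : cos (pi / (p_ j)%:R) != 0 :> R by rewrite gt_eqF ?cos_pi_div_gt0.
have a0 := cos_pi_div_ge0 R hk; have b0 := cos_pi_div_ge0 R hl.
have ab : (cos (pi / k%:R) != 0 :> R) || (cos (pi / l%:R) != 0 :> R).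
  have [k3|k3] := leqP 3 k; first by rewrite gt_eqF ?cos_pi_div_gt0.
  have [l3|l3] := leqP 3 l; first by rewrite orbC gt_eqF ?cos_pi_div_gt0.
  by case: hkl; congr pair; apply/eqP; rewrite eqn_leq ?hk ?hl -ltnS ?k3 ?l3.
have adm m : (7 <= m)%N -> admissible k l m by exact: admissible_ge7.
have m2 m : (7 <= m)%N -> (2 <= m)%N by exact: leq_trans.
have gram m (m7 : (7 <= m)%N) :=
  coxeter_prism_gram hk hl (m2 m m7) (hP _ (adm _ m7)).
have det m (m7 : (7 <= m)%N) := gram_det_lt0 R hk hl hkl m7.
have c1 m (m7 : (7 <= m)%N) := cos_pi_div_sqr_lt1 R (m2 m m7).
have BT m (m7 : (7 <= m)%N) :=
  gram_base_product_gt1 (gram m m7) (det m m7) p0 (c1 m m7).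
have sG m : is_subgroup (reflection_group (P m)) := generated_subgroup_subgroup _.
split.
  move=> fin; apply: infinite_primes_ge7.
  pose cls m := commensurability_class (reflection_group (P m)).
  set D := [set _ | m in _] in fin.
  (* If there were finitely many classes, the primes from 7 on would be a finite union of fibres of
     [cls]; each fibre is shown to be finite. *)
  apply: (@sub_finite_set _ _ (\bigcup_(C in D)
    [set m | prime m && (7 <= m)%N /\ cls m = C])) => [m /andP[pm m7]|].
    by exists (cls m); [exists m => //; exact: adm|rewrite /= pm m7].
  apply: bigcup_finite fin _ => C _.
  set E := [set m | _ /\ _].
  have [[m0 [/andP[pm0 m07] Cm0]]|noE] := pselect (E !=set0); last first.
    suff -> : E = set0 by exact: finite_set0.
    by apply/seteqP; split=> // m Em; apply: noE; exists m.
  have d0 : gram_det (cos (pi / k%:R)) (cos (pi / l%:R)) (cos (pi / m0%:R)) != 0 :> R.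
    by rewrite lt_eqF ?det.
  have [|J [w Jw]] := reflection_group_qspan (gram_unit (gram m0 m07))
      (gram_basis_unit (gram m0 m07) d0).
    apply: (prism_gram_algebraic (gram m0 m07) d0) => x.
    rewrite !inE => /or4P[] /eqP ->; apply: algebraic_cos_pi_div => //.
    - exact: leq_trans hk.
    - exact: leq_trans hl.
    - exact: leq_trans m07.
    - exact: leq_trans pj.
  apply: (@sub_finite_set _ _ `I_(#|J|.+2)); last exact: finite_II.
  move=> m [/andP[pm m7] Cm] /=; rewrite ltnS -(prednK (prime_gt0 pm)) ltnS.
  apply: (commensurable_prime_bound (sG m0) Jw (gram m m7) p0 ab (BT m m7) pm).
  (* By reflexivity the group of [P m] lies in its own class, which equals that of [P m0]. *)
  have : cls m0 (reflection_group (P m)).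
    by rewrite Cm0 -Cm; split; [exact: sG|exact: commensurable_refl].
  by case.
have dist_cvg := cvg_base_distance (cos (pi / (p_ j)%:R)) a0 b0 ab
  (@cvg_cos_pi_div R).
(* The systole lies between 0 and the translation length of the product of the reflections in [Bot]
   and [Top]. *)
apply: (squeeze_cvge _ (cvg_cst 0%E) dist_cvg).
near=> m.
have m7 : (7 <= m)%N by near: m; exact: nbhs_infty_ge.
rewrite systole_ge0/=; have nu := gram_unit (gram m m7).
rewrite -(gram_base_product (gram m m7)) ?lt_eqF ?det//.
have [rB fB] := reflection_exists (nu Bot).
have [rT fT] := reflection_exists (nu Top).
apply: (reflections_systole_le (nu _) (nu _) (BT m m7) fB fT).
apply: (subgroupM (sG m)); exact: reflection_group_reflection.
Unshelve. all: by end_near.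
Qed.
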